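(* The family of spaces $A^k(T)$ (lowest order case) is closed under traces and the exterior derivative: for every cell $T$, every $k$ and every $u \in A^k(T)$, one has $u|_{T'} \in A^k(T')$ for every face $T'$ of $T$, and $\mathrm{d} u \in A^{k+1}(T)$.
   Context: $T$ denotes a polytope (a flat cell of a polytopal mesh) of dimension $d$, oriented and equipped with the Euclidean metric. Its faces $T'$ include $T$ itself; each face is also a cell, and is oriented. Differential forms are real valued; the trace $u|_{T'}$ of a form $u$ on a face $T'$ is its pullback by the inclusion $T' \to T$. $X^k(T)$ is the space of $k$-forms $u$ in $L^2(T)$ with $\mathrm{d}u$ in $L^2(T)$; $|\cdot|$ is the $L^2$ norm, $\|\cdot\|$ the graph norm on $X^k(T)$, and $X^k_0(T)=\{u\in X^k(T): u|_{\partial T}=0\}$ (so $X^d_0(T)=X^d(T)$). The pointwise scalar product of forms is $u\cdot v$; orthogonality $\perp$ is with respect to the $L^2$ scalar product. $\mathrm{P}^s\Lambda^k(T)$ is the space of polynomial $k$-forms of degree at most $s$. With $b_T$ the barycentre of $T$, $\kappa_T$ denotes contraction of forms by the vector field $x\mapsto x-b_T$, and $\mathrm{P}^s_-\Lambda^k(T)=\{u\in \mathrm{P}^s\Lambda^k(T): \kappa_T u\in \mathrm{P}^s\Lambda^{k-1}(T)\}$. Spaces of $k$-forms with $k<0$ or $k>d$ are zero. For $d\ge 1$: $W^k(T)=\mathrm{P}^1_-\Lambda^k(T)$ for $k\geq 1$, and $W^0(T)$ is the space of those $w\in \mathrm{P}^1_-\Lambda^0(T)=\mathrm{P}^1(T)$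 with integral $0$ on $T$. Set $$Z^k_0(T)=\{u\in X^k_0(T): \forall w\in W^{d-k}(T)\ \int_T u\wedge w=0\},\qquad Y^k(T)=\{u\in Z^k_0(T): u\perp \mathrm{d}Z^{k-1}_0(T)\}.$$ $B^k(T)$ is the space of $u\in X^k(T)$ for which there exist $a\in \mathrm{P}^0\Lambda^{d-k}(T)$, $b\in \mathrm{P}^0\Lambda^{d-k+1}(T)$ and $v\in Y^{k-1}(T)$ such that $$\int_T \mathrm{d}u\cdot \mathrm{d}u' + \int_T \mathrm{d}u'\wedge\kappa_T a+\int_T u'\wedge\kappa_T b+\int_T u'\cdot \mathrm{d}v=0,$$ $$\int_T \mathrm{d}u\wedge\kappa_T a'=0,\quad \int_T u\wedge\kappa_T b'=0,\quad \int_T u\cdot \mathrm{d}v'=0,$$ for all $u'\in X^k_0(T)$, $a'\in \mathrm{P}^0\Lambda^{d-k}(T)$, $b'\in \mathrm{P}^0\Lambda^{d-k+1}(T)$, $v'\in Y^{k-1}(T)$. For $T$ a point, $B^0(T)=\mathbb{R}$. $A^k(T)$ is the space of $u\in X^k(T)$ such that $u|_{T'}\in B^k(T')$ for every face $T'$ of $T$ (including $T'=T$). *)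

(* Defs.v *)
From HB Require Import structures.
From mathcomp Require Import all_boot all_order all_algebra.
From mathcomp Require Import all_classical all_reals all_analysis.
Set Implicit Arguments.
Unset Strict Implicit.
Unset Printing Implicit Defensive.
Import Order.TTheory GRing.Theory Num.Theory.
Import numFieldNormedType.Exports.
Local Open Scope classical_set_scope.
Local Open Scope ring_scope.

(* Lebesgue measure on R^d, as the d-fold product of the one-dimensional
   one; on R^0 it is the unit mass at the only point. *)
Section lebesgue_nd.
Context {R : realType}.
Notation Rn d := (d.-tuple (measurableTypeR R)).

Definition tcons d (p : measurableTypeR R * Rn d) : Rn d.+1 := [tuple of p.1 :: p.2].

Lemma measurable_tcons d : measurable_fun setT (@tcons d).
Proof. exact: measurable_cons. Qed.

HB.instance Definition _ d :=
  @isMeasurableFun.Build _ _ _ _ (@tcons d) (@measurable_tcons d).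

Section step.
Context d (mu : {sigma_finite_measure set (Rn d) -> \bar R}).

Definition lebesgueS : set (Rn d.+1) -> \bar R :=
  pushforward (lebesgue_measure \x mu)%E (@tcons d).

Let lebesgueS0 : lebesgueS set0 = 0%E.
Proof. by rewrite /lebesgueS /pushforward preimage_set0 measure0. Qed.

Let lebesgueS_ge0 A : (0 <= lebesgueS A)%E.
Proof. exact: measure_ge0. Qed.

Let lebesgueS_sigma_additive : semi_sigma_additive lebesgueS.
Proof.
exact: (@measure_semi_sigma_additive _ _ _
  (pushforward (lebesgue_measure \x mu)%E (@tcons d))).
Qed.

HB.instance Definition _ := isMeasure.Build _ _ _ lebesgueS
  lebesgueS0 lebesgueS_ge0 lebesgueS_sigma_additive.

Let lebesgueS_sigma_finite : sigma_finite setT lebesgueS.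
Proof.
have /sigma_finiteP[F [TF ndF Foo]] := sigma_finiteT (@lebesgue_measure R).
have /sigma_finiteP[G [TG ndG Goo]] := sigma_finiteT mu.
pose g (t : Rn d.+1) := (thead t, [tuple of behead t]) : measurableTypeR R * Rn d.
have tconsK : cancel (@tcons d) g.
  by move=> [x t]; rewrite /g /tcons theadE; congr pair; exact: val_inj.
have mg : measurable_fun setT g.
  by apply: measurable_fun_pair; [exact: measurable_tnth|exact: measurable_behead].
exists (fun i => g @^-1` (F i `*` G i)).
  rewrite predeqE => t; split => // _.
  have [i _ Fi] : (\bigcup_i F i) (g t).1 by rewrite -TF.
  have [j _ Gj] : (\bigcup_i G i) (g t).2 by rewrite -TG.
  exists (maxn i j) => //; split => /=.
  - by move: Fi; exact/subsetPset/ndF/leq_maxl.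
  - by move: Gj; exact/subsetPset/ndG/leq_maxr.
move=> i; have [mF Fi] := Foo i; have [mG Gi] := Goo i.
split; first by rewrite -[_ @^-1` _]setTI; apply: mg => //; exact: measurableX.
rewrite /lebesgueS /pushforward -comp_preimage (_ : g \o @tcons d = id); last exact/funext.
by rewrite product_measure1E// lte_mul_pinfty// ge0_fin_numE.
Qed.

HB.instance Definition _ :=
  @Measure_isSigmaFinite.Build _ _ _ lebesgueS lebesgueS_sigma_finite.
End step.

Fixpoint lebesgue_nd d : {sigma_finite_measure set (Rn d) -> \bar R} :=
  match d with
  | 0 => dirac [tuple]
  | d'.+1 => lebesgueS (lebesgue_nd d')
  end.
End lebesgue_nd.

Section cells.
Context {R : realType} {n : nat}.
Notation E := 'rV[R]_n.

Definition dotv (v w : E) : R := \sum_i v 0 i * w 0 i.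

Definition polytope (T : set E) : Prop :=
  exists2 s : seq E, s <> [::] &
    T = [set x | exists c : 'I_(size s) -> R,
      [/\ forall i, 0 <= c i, \sum_i c i = 1 & x = \sum_i c i *: s`_i]].

(* A segment of T whose interior meets F lies in F; in particular T is a face
   of itself. *)
Definition face (F T : set E) : Prop :=
  [/\ F `<=` T, F !=set0, convex_set (F : set (convex_lmodType E)) &
    forall (x y : E) (t : R), T x -> T y -> 0 < t < 1 ->
      F ((1 - t) *: x + t *: y) -> F x /\ F y].

(* e is an orthonormal basis of the vector space parallel to F: the smallest
   one that contains all differences of points of F. *)
Definition orthonormal_frame (F : set E) (e : seq E) : Prop :=
  [/\ forall i j, (i < size e)%N -> (j < size e)%N ->
        dotv e`_i e`_j = (i == j)%:R,
      forall x y, F x -> F y -> x - y \in <<e>>%VS &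
      forall V : {vspace E}, (forall x y, F x -> F y -> x - y \in V) ->
        (<<e>> <= V)%VS].

(* Differential forms of all degrees: u x vs is the value at the point x on
   the list vs of vectors, so that a k-form vanishes on the lists whose length
   is not k. A form on T is such a function considered only at points of T and
   on vectors tangent to T; restricting it further to a face of T is then the
   pullback by the inclusion, when it is defined pointwise. Degrees are
   integers, and a form of degree k < 0 or k > dim T is zero. *)
Definition dform := E -> seq E -> R.

Definition altform (V : {vspace E}) (k : int) (w : seq E -> R) : Prop :=
  [/\ forall vs, {subset vs <= V} -> w vs <> 0 -> (size vs)%:Z = k,
      forall (a : R) v v' vs1 vs2, {subset v :: v' :: vs1 ++ vs2 <= V} ->
        w (vs1 ++ (a *: v + v') :: vs2) =
          a * w (vs1 ++ v :: vs2) + w (vs1 ++ v' :: vs2) &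
      forall vs, {subset vs <= V} -> ~~ uniq vs -> w vs = 0].

(* (u /\ w)(v_1, ..., v_m) is the signed sum over all shuffles: the mask s
   selects the arguments of u, the others go to w. *)
Definition wedge (u w : dform) : dform := fun x vs =>
  \sum_(s : (size vs).-tuple bool)
    (-1) ^+ (\sum_(i < size vs) \sum_(j < size vs | (i < j)%N)
               (~~ tnth s i && tnth s j))
    * u x (mask s vs) * w x (mask (map negb s) vs).

Definition smooth (f : E -> R) : Prop :=
  forall (vs : seq E) (x : E),
    differentiable (foldr (fun v (g : E -> R) => 'D_v g) f vs) x.

Definition smooth_form (k : int) (phi : dform) : Prop :=
  (forall x, altform fullv k (phi x)) /\ (forall vs, smooth (phi^~ vs)).

(* exterior derivative of a smooth form *)
Definition dsmooth (phi : dform) : dform := fun x vs =>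
  \sum_(i < size vs)
    (-1) ^+ i * 'D_(vs`_i) (fun y : E => phi y (take i vs ++ drop i.+1 vs)) x.

Definition vanishes_near (S : set E) (phi : dform) : Prop :=
  exists U : set E, [/\ open U, S `<=` U & forall x vs, U x -> phi x vs = 0].

Fixpoint polyfun (s : nat) (f : E -> R) : Prop :=
  match s with
  | 0%N => exists c, forall x, f x = c
  | s'.+1 => exists c (g : 'I_n -> E -> R), (forall i, polyfun s' (g i)) /\
      forall x, f x = c + \sum_i x 0 i * g i x
  end.

(* o F is an orthonormal basis of the space parallel to the cell F, positive
   for the orientation of F. A point has the empty basis and is oriented
   positively. *)
Variable o : set E -> seq E.

Definition dim (T : set E) : nat := size (o T).

Definition tangent (T : set E) : {vspace E} := <<o T>>%VS.

Definition relint (T : set E) : set E :=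
  [set x | T x /\ exists2 eps : R, 0 < eps &
             forall v, v \in tangent T -> `|v| < eps -> T (x + v)].

Definition relbd (T : set E) : set E := T `\` relint T.

(* isometric coordinates on the affine span of T *)
Definition chart (T : set E) (y : (dim T).-tuple (measurableTypeR R)) : E :=
  xget 0 T + \sum_(i < dim T) (tnth y i : R) *: (o T)`_i.
Arguments chart : clear implicits.

Definition chart_dom (T : set E) : set ((dim T).-tuple (measurableTypeR R)) :=
  chart T @^-1` relint T.
Arguments chart_dom : clear implicits.

(* The relative boundary of a polytope is negligible: integrals over T are
   taken over its relative interior. *)
Definition integral_fun (T : set E) (f : E -> R) : R :=
  \int[lebesgue_nd (dim T)]_(y in chart_dom T) f (chart T y).

(* integral over T of a form of degree dim T *)
Definition integral_form (T : set E) (u : dform) : R :=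
  integral_fun T (u^~ (o T)).

(* L^2 scalar product of two forms; the masks of the orthonormal basis o T are
   the increasing lists of its vectors. *)
Definition dot_form (T : set E) (u v : dform) : R :=
  integral_fun T (fun x => \sum_(s : (dim T).-tuple bool)
                             u x (mask s (o T)) * v x (mask s (o T))).

Definition is_form (T : set E) (k : int) (u : dform) : Prop :=
  forall x, T x -> altform (tangent T) k (u x).

Definition L2 (T : set E) (k : int) (u : dform) : Prop :=
  is_form T k u /\
  forall s : (dim T).-tuple bool,
    let f := fun y => u (chart T y) (mask s (o T)) in
    measurable_fun (chart_dom T) f /\
    (lebesgue_nd (dim T)).-integrable (chart_dom T)
      (fun y => (f y ^+ 2)%:E).

(* For f = du, by the Stokes formula, this is the integral over the boundary
   of T of u /\ phi. *)
Definition stokes (T : set E) (k : int) (u f phi : dform) : R :=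
  integral_form T (wedge f phi)
  + (-1) ^ k * integral_form T (wedge u (dsmooth phi)).

Definition is_ext_d (T : set E) (k : int) (u f : dform) : Prop :=
  L2 T (k + 1) f /\
  forall phi, smooth_form ((dim T)%:Z - k - 1) phi ->
    vanishes_near (relbd T) phi -> stokes T k u f phi = 0.

(* exterior derivative, in the sense of distributions on the interior of T,
   of a k-form in X^k(T); unique up to a negligible set *)
Definition ext_d (T : set E) (k : int) (u : dform) : dform :=
  xget ((fun _ _ => 0) : dform) [set f | is_ext_d T k u f].

Definition spaceX (T : set E) (k : int) (u : dform) : Prop :=
  L2 T k u /\ exists f, is_ext_d T k u f.

Definition spaceX0 (T : set E) (k : int) (u : dform) : Prop :=
  spaceX T k u /\
  forall phi, smooth_form ((dim T)%:Z - k - 1) phi ->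
    stokes T k u (ext_d T k u) phi = 0.

Definition barycentre (T : set E) : E :=
  \row_i (integral_fun T (fun x => x 0 i) / integral_fun T (fun=> 1)).

Definition kappa (T : set E) (u : dform) : dform :=
  fun x vs => u x ((x - barycentre T) :: vs).

Definition spaceP (T : set E) (s : nat) (k : int) (u : dform) : Prop :=
  is_form T k u /\
  forall vs, {subset vs <= tangent T} ->
    exists2 p, polyfun s p & forall x, T x -> u x vs = p x.

Definition spacePminus (T : set E) (s : nat) (k : int) (u : dform) : Prop :=
  spaceP T s k u /\ spaceP T s (k - 1) (kappa T u).

Definition spaceW (T : set E) (k : int) (w : dform) : Prop :=
  spacePminus T 1 k w /\ (k = 0 -> integral_fun T (w^~ [::]) = 0).

Definition spaceZ0 (T : set E) (k : int) (u : dform) : Prop :=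
  spaceX0 T k u /\
  forall w, spaceW T ((dim T)%:Z - k) w -> integral_form T (wedge u w) = 0.

Definition spaceY (T : set E) (k : int) (u : dform) : Prop :=
  spaceZ0 T k u /\
  forall z, spaceZ0 T (k - 1) z -> dot_form T u (ext_d T (k - 1) z) = 0.

(* On a point, this is the whole of X^k, hence R in degree 0 and zero in the
   other degrees. *)
Definition spaceB (T : set E) (k : int) (u : dform) : Prop :=
  spaceX T k u /\
  ((0 < dim T)%N ->
   let du := ext_d T k u in
   let l := (dim T)%:Z - k in
   exists a b v,
     [/\ spaceP T 0 l a, spaceP T 0 (l + 1) b, spaceY T (k - 1) v &
       [/\ forall u', spaceX0 T k u' ->
             let du' := ext_d T k u' in
             dot_form T du du' + integral_form T (wedge du' (kappa T a))
             + integral_form T (wedge u' (kappa T b))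
             + dot_form T u' (ext_d T (k - 1) v) = 0,
           forall a', spaceP T 0 l a' ->
             integral_form T (wedge du (kappa T a')) = 0,
           forall b', spaceP T 0 (l + 1) b' ->
             integral_form T (wedge u (kappa T b')) = 0 &
           forall v', spaceY T (k - 1) v' ->
             dot_form T u (ext_d T (k - 1) v') = 0]]).

Definition facet (G F : set E) : Prop :=
  face G F /\ dim F = (dim G).+1.

Definition outward_normal (F G : set E) (nu : E) : Prop :=
  [/\ nu \in tangent F, dotv nu nu = 1, forall v, v \in tangent G -> dotv nu v = 0
    & forall x y, F x -> G y -> dotv nu (x - y) <= 0].

(* g is the trace of u on the facet G of F. The test forms are supported away
   from the other facets, and the determinant is the sign of the orientation
   of G relative to the one induced by F (outward normal first). *)
Definition facet_trace (F G : set E) (k : int) (u g : dform) : Prop :=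
  exists2 nu, outward_normal F G nu &
    forall phi, smooth_form ((dim F)%:Z - k - 1) phi ->
      vanishes_near (relbd F `\` relint G) phi ->
      stokes F k u (ext_d F k u) phi =
        \det (\matrix_(i < dim F, j < dim F) dotv (nu :: o G)`_i (o F)`_j)
        * integral_form G (wedge g phi).

(* w F is the trace on F of w T, for every face F of T; the traces on faces of
   codimension greater than 1 are iterated traces on facets. By the test forms
   of facet_trace, each trace is unique up to a negligible set. *)
Definition traces (T : set E) (k : int) (w : set E -> dform) : Prop :=
  (forall F, face F T -> spaceX F k (w F)) /\
  (forall F G, face F T -> facet G F -> facet_trace F G k (w F) (w G)).

Definition is_trace (T F : set E) (k : int) (u g : dform) : Prop :=
  exists2 w, traces T k w & w T = u /\ w F = g.

Definition spaceA (T : set E) (k : int) (u : dform) : Prop :=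
  spaceX T k u /\
  exists w, [/\ traces T k w, w T = u & forall F, face F T -> spaceB F k (w F)].

End cells.

(* Main.v *)
Set Warnings "-notation-overridden -ambiguous-paths -notation-incompatible-prefix".
From mathcomp Require Import all_boot all_order all_algebra.
From mathcomp Require Import all_classical all_reals all_analysis measurable_realfun.
From mathcomp Require Import ring lra.
Require Import Defs.
Set Implicit Arguments.
Unset Strict Implicit.
Unset Printing Implicit Defensive.
Import Order.TTheory GRing.Theory Num.Theory.
Import numFieldNormedType.Exports.
Local Open Scope classical_set_scope.
Local Open Scope ring_scope.

(** The first assertion is formal: a face of a face is a face, so that a
    family of traces that witnesses the membership of u in A^k(T) restricts to
    each face.

    For the second one, the witnesses are the weak derivatives d(u|_F) of the
    given traces. Three points have to be checked on each face F.

    The form d(u|_F) is in X^{k+1}(F) with derivative zero, since d d phi = 0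
    for every test form phi (dsmooth_dsmooth, is_ext_d_ext_d).

    These forms are traces of each other (facet_trace_ext_d). Apply to d phi
    the identity that says that u|_G is the trace of u|_F on a facet G. As d d
    phi = 0, its left-hand side is, up to sign, the boundary pairing of
    d(u|_F) with phi. A test form phi that vanishes near the other facets
    vanishes near the relative boundary of G, so that the definition of
    d(u|_G) turns the right-hand side into the pairing of d(u|_G) with phi.

    They belong to B^{k+1}(F) (spaceB_ext_d). The multipliers can be taken to
    be zero. The orthogonality of d(u|_F) to contractions of constant forms is
    one of the equations of u|_F. What remains is the orthogonality of d(u|_F)
    to dY^k(F), and it is the first equation for u|_F with a test function v'
    in Y^k(F): the term in b vanishes because the contraction of b belongs to
    W, the term in v by the definition of Y^k(F), and the term in a because
    Stokes' formula and the homotopy formula d kappa a = (deg a) a, for a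
    constant form a, reduce it to the pairing of v' with a multiple of a,
    which belongs to W (spaceZ0_kappa, spaceZ0_ext_d_kappa).

    Two facts from analysis support this. Second derivatives commute
    (schwarz), which gives d d phi = 0. And a form whose pairing with all test
    forms is zero vanishes almost everywhere (weak_zero): weak derivatives are
    picked by choice, so that the derivative of a closed form is only known to
    be zero through this uniqueness. *)

(** * Smooth functions and the symmetry of second derivatives *)

Section smooth_functions.
Context {R : realType} {n : nat}.
Notation E := 'rV[R]_n.
Implicit Types (f g : E -> R) (u v x : E).

Lemma smooth_differentiable f x : smooth f -> differentiable f x.
Proof. by move=> sf; exact: (sf [::]). Qed.

Lemma smooth_derivable f x v : smooth f -> derivable f x v.
Proof. by move=> /smooth_differentiable sf; apply: diff_derivable. Qed.

Lemma smooth_derive f v : smooth f -> smooth ('D_v f).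
Proof. by move=> sf vs x; have := sf (rcons vs v) x; rewrite foldr_rcons. Qed.

(** Smoothness is a greatest fixed point, so a class of differentiable
    functions that is stable under directional derivatives consists of smooth
    functions. *)
Lemma smooth_coind (P : (E -> R) -> Prop) :
    (forall f, P f -> (forall x, differentiable f x) /\ forall v, P ('D_v f)) ->
  forall f, P f -> smooth f.
Proof.
move=> HP f Pf vs; suff /HP[] : P (foldr (fun v (g : E -> R) => 'D_v g) f vs) by [].
by elim: vs => [//|v vs IH] /=; have [_] := HP _ IH; apply.
Qed.

(** The algebra generated by a class of functions. By the Leibniz rule it is
    stable under directional derivatives as soon as the derivatives of its
    generators belong to it, which reduces smoothness to the generators. *)
Inductive generated (C : (E -> R) -> Prop) : (E -> R) -> Prop :=
| gen_base f : C f -> generated C f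
| gen_cst c : generated C (cst c)
| gen_add f g : generated C f -> generated C g -> generated C (f + g)
| gen_mul f g : generated C f -> generated C g -> generated C (f * g).

Lemma generated_smooth (C : (E -> R) -> Prop) :
    (forall f, C f -> (forall x, differentiable f x) /\
                      forall v, generated C ('D_v f)) ->
  forall f, generated C f -> smooth f.
Proof.
move=> HC; apply: smooth_coind => f; elim=> {f}.
- by move=> f /HC.
- move=> c; split=> [x|v]; first exact: differentiable_cst.
  have -> : 'D_v (cst c : E -> R) = cst 0 by apply/funext => x; rewrite derive_cst.
  exact: gen_cst.
- move=> f g _ [df Df] _ [dg Dg]; split=> [x|v]; first exact: differentiableD.
  have -> : 'D_v (f + g) = 'D_v f + 'D_v g.
    by apply/funext => x; rewrite deriveD//; apply: diff_derivable.
  exact: gen_add.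
- move=> f g gf [df Df] gg [dg Dg]; split=> [x|v]; first exact: differentiableM.
  have -> : 'D_v (f * g) = f * 'D_v g + g * 'D_v f.
    apply/funext => x; rewrite deriveM//; exact: diff_derivable.
  by apply: gen_add; apply: gen_mul.
Qed.

Lemma smooth_cst c : smooth (cst c : E -> R).
Proof. by apply: (@generated_smooth (fun=> False)) => //; exact: gen_cst. Qed.

Lemma generated_smooth_smooth f : generated smooth f -> smooth f.
Proof.
apply: generated_smooth => g sg; split=> [x|v]; first exact: smooth_differentiable.
by apply: gen_base; apply: smooth_derive.
Qed.

Lemma smoothD f g : smooth f -> smooth g -> smooth (f + g).
Proof.
by move=> sf sg; apply: generated_smooth_smooth; apply: gen_add; apply: gen_base.
Qed.

Lemma smoothM f g : smooth f -> smooth g -> smooth (f * g).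
Proof.
by move=> sf sg; apply: generated_smooth_smooth; apply: gen_mul; apply: gen_base.
Qed.

Lemma smoothN f : smooth f -> smooth (- f).
Proof.
move=> sf; rewrite (_ : - f = cst (- 1) * f).
  by apply: smoothM => //; exact: smooth_cst.
by apply/funext => x /=; rewrite [in RHS]/GRing.mul/= mulN1r.
Qed.

Lemma smoothB f g : smooth f -> smooth g -> smooth (f - g).
Proof. by move=> sf sg; apply: smoothD => //; exact: smoothN. Qed.

Lemma smooth_prod (I : Type) (r : seq I) (P : pred I) (F : I -> E -> R) :
  (forall i, P i -> smooth (F i)) -> smooth (\prod_(i <- r | P i) F i).
Proof.
by move=> sF; elim/big_ind: _ => //; [exact: smooth_cst|exact: smoothM].
Qed.

(** Linearity in the shape in which the slots of an alternating form provide
    it. *)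
Definition scalar_linear (l : E -> R) :=
  forall a x y, l (a *: x + y) = a * l x + l y.

Section scalar_linear.
Variables (l : E -> R) (ll : scalar_linear l).

Lemma scalar_linear0 : l 0 = 0.
Proof. by have := ll (-1) 0 0; rewrite scaler0 addr0 mulN1r addNr. Qed.

Lemma scalar_linearD x y : l (x + y) = l x + l y.
Proof. by have := ll 1 x y; rewrite scale1r mul1r. Qed.

Lemma scalar_linearZ a x : l (a *: x) = a * l x.
Proof. by have := ll a x 0; rewrite !addr0 scalar_linear0 addr0. Qed.

Lemma scalar_linear_sum (I : Type) (r : seq I) (P : pred I) (F : I -> E) :
  l (\sum_(i <- r | P i) F i) = \sum_(i <- r | P i) l (F i).
Proof. exact: (big_morph l scalar_linearD scalar_linear0). Qed.

(** In finite dimension this makes every linear functional differentiable. *)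
Lemma scalar_linearE x : l x = \sum_(i < n) x 0 i * l (delta_mx 0 i).
Proof.
rewrite {1}[x]row_sum_delta scalar_linear_sum.
by apply: eq_bigr => i _; rewrite scalar_linearZ.
Qed.

Lemma differentiable_scalar_linear x : differentiable l x.
Proof.
have -> : l = \sum_(i < n) (fun x => x 0 i * l (delta_mx 0 i)).
  by apply/funext => y; rewrite scalar_linearE fct_sumE.
apply: differentiable_sum => i; apply: differentiableM.
  exact: differentiable_coord.
exact: differentiable_cst.
Qed.

Lemma derive_scalar_linear v x : 'D_v l x = l v.
Proof.
rewrite /derive; apply: cvg_lim => //.
apply: cvg_near_cst; near=> h; rewrite /=.
rewrite scalar_linearD addrK scalar_linearZ [_ *: _]mulrA mulVf ?mul1r//.
by near: h; exact: nbhs_dnbhs_neq.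
Unshelve. all: by end_near. Qed.

Lemma smooth_scalar_linear : smooth l.
Proof.
apply: (@generated_smooth (eq l)); last exact: gen_base.
move=> _ <-; split=> [x|v]; first exact: differentiable_scalar_linear.
have -> : 'D_v l = cst (l v) by apply/funext => x; exact: derive_scalar_linear.
exact: gen_cst.
Qed.

End scalar_linear.

Lemma is_derive_line f v x (t : R) : differentiable f (t *: v + x) ->
  is_derive t 1 (fun s : R => f (s *: v + x)) ('D_v f (t *: v + x)).
Proof.
move=> df.
have e : (fun h : R => h^-1 *: (f ((h *: 1 + t) *: v + x) - f (t *: v + x))) =
           (fun h : R => h^-1 *: (f (h *: v + (t *: v + x)) - f (t *: v + x))).
  by apply/funext => h; rewrite scalerDl [h *: 1]mulr1 addrA.
split; last by rewrite /derive /= e.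
by have := diff_derivable (v:=v) df; rewrite /derivable/= e.
Qed.

Lemma mvt_line f v x (h : R) : 0 < h -> (forall y, differentiable f y) ->
  exists2 s : R, 0 < s < h & f (h *: v + x) - f x = h * 'D_v f (s *: v + x).
Proof.
move=> h0 df.
have [||s] := @MVT R (fun s => f (s *: v + x)) (fun s => 'D_v f (s *: v + x)) 0 h h0.
- by move=> t _; exact: is_derive_line.
- apply: derivable_within_continuous => t _.
  by have [] := is_derive_line (df (t *: v + x)).
- rewrite in_itv/= => s0h; rewrite scale0r add0r subr0 => e.
  by exists s => //; rewrite e mulrC.
Qed.

(** Two applications of the mean value theorem, first along u to the increment
    of f in the direction v, then along v to the derivative of f along u. *)
Lemma second_difference f u v x (h : R) : smooth f -> 0 < h ->
  exists s t : R, [/\ 0 < s < h, 0 < t < h &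
    f (h *: v + (h *: u + x)) - f (h *: u + x) - (f (h *: v + x) - f x) =
      h * (h * 'D_v ('D_u f) (t *: v + (s *: u + x)))].
Proof.
move=> sf h0.
pose g y := f (h *: v + y) - f y.
have dshift y : differentiable (fun z => f (h *: v + z)) y.
  apply: (@differentiable_comp _ _ _ _ (fun z => h *: v + z) f).
    by apply: differentiableD; [exact: differentiable_cst|exact: ex_diff].
  exact: smooth_differentiable.
have dg y : differentiable g y.
  by apply: differentiableB; [exact: dshift|exact: smooth_differentiable].
have Dg y : 'D_u g y = 'D_u f (h *: v + y) - 'D_u f y.
  rewrite deriveB; last 2 first.
  - exact: (diff_derivable (dshift y)).
  - exact: smooth_derivable.
  have e : (fun k : R => k^-1 *: (f (h *: v + (k *: u + y)) - f (h *: v + y))) =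
           (fun k : R => k^-1 *: (f (k *: u + (h *: v + y)) - f (h *: v + y))).
    by apply/funext => k; rewrite addrCA.
  by congr (_ - _); rewrite /derive /= e.
have [s s0h gs] := mvt_line u x h0 dg.
have [t t0h Dt] := mvt_line v (s *: u + x) h0
  (fun y => smooth_differentiable y (smooth_derive u sf)).
by exists s, t; split => //; rewrite -Dt -Dg -gs.
Qed.

(** The second difference of f over a small parallelogram is symmetric in the
    two sides. By the mean value theorem it equals the square of the scale
    times either mixed derivative at some nearby point; continuity of both
    mixed derivatives at x then forces them to agree there. *)
Theorem schwarz f u v x : smooth f -> 'D_u ('D_v f) x = 'D_v ('D_u f) x.
Proof.
move=> sf.
have [F FE] : {F : E -> R | F = 'D_u ('D_v f)} by exact: (exist _ _ erefl).
have [G GE] : {G : E -> R | G = 'D_v ('D_u f)} by exact: (exist _ _ erefl).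
have cF : {for x, continuous F}.
  rewrite FE; apply/differentiable_continuous/smooth_differentiable.
  exact/smooth_derive/smooth_derive.
have cG : {for x, continuous G}.
  rewrite GE; apply/differentiable_continuous/smooth_differentiable.
  exact/smooth_derive/smooth_derive.
have FEx y : 'D_u ('D_v f) y = F y by rewrite FE.
have GEx y : 'D_v ('D_u f) y = G y by rewrite GE.
rewrite FEx GEx; apply/eqP; rewrite -subr_eq0 -normr_le0.
apply/ler_addgt0Pl => e e0; rewrite addr0.
have near_x (H : E -> R) : {for x, continuous H} ->
    exists2 r, 0 < r & forall y, `|y| < r -> `|H x - H (y + x)| < e / 2.
  move=> /cvgrPdist_lt/(_ (e / 2)); rewrite divr_gt0// => /(_ isT).
  move=> /nbhs_ballP[r r0 xr]; exists r => // y yr; apply: xr.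
  by rewrite -ball_normE/= opprD addrC addrNK normrN.
have [r1 r1_gt0 H1] := near_x _ cF.
have [r2 r2_gt0 H2] := near_x _ cG.
pose m := `|u| + `|v| + 1.
have m0 : 0 < m by rewrite /m ltr_wpDl// addr_ge0.
(* A scale h for which every point of the parallelogram is at distance less
   than r1 and r2 from x. *)
pose h := Num.min r1 r2 / m.
have h0 : 0 < h by rewrite divr_gt0// lt_min r1_gt0.
have hr (s t : R) (a b : E) : `|a| + `|b| + 1 = m -> 0 < s < h -> 0 < t < h ->
    `|t *: b + s *: a| < Num.min r1 r2.
  move=> abm /andP[s0 sh] /andP[t0 th].
  have -> : Num.min r1 r2 = h * m by rewrite divfK// gt_eqF.
  apply: (le_lt_trans (ler_normD _ _)); rewrite !normrZ !gtr0_norm//.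
  apply: (@le_lt_trans _ _ (h * (`|a| + `|b|))).
    by rewrite mulrDr addrC lerD// ler_wpM2r// ltW.
  by rewrite ltr_pM2l// -abm ltrDl.
have [s1 [t1 [s1h t1h e1]]] := second_difference v u x sf h0.
have [s2 [t2 [s2h t2h e2]]] := second_difference u v x sf h0.
rewrite FEx in e1; rewrite GEx in e2.
have e12 : F (t1 *: u + (s1 *: v + x)) = G (t2 *: v + (s2 *: u + x)).
  apply: (mulfI (lt0r_neq0 h0)); apply: (mulfI (lt0r_neq0 h0)).
  rewrite -e1 -e2 (addrCA (h *: u) (h *: v)).
  by rewrite !opprB !addrA addrAC [RHS]addrAC (addrAC (f _)).
have vu1 : `|t1 *: u + s1 *: v| < r1.
  have := hr s1 t1 v u; rewrite lt_min (addrC `|v|) => /(_ erefl s1h t1h).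
  by case/andP.
have uv2 : `|t2 *: v + s2 *: u| < r2.
  by have := hr s2 t2 u v; rewrite lt_min => /(_ erefl s2h t2h)/andP[].
have := H1 _ vu1; have := H2 _ uv2; rewrite -!(addrA _ _ x).
rewrite e12 => A B; rewrite (splitr e) -(subrKA (G (t2 *: v + (s2 *: u + x)))).
by apply: (le_trans (ler_normD _ _)); apply: lerD; rewrite ltW// distrC.
Qed.

End smooth_functions.

(** * The exterior derivative of smooth forms *)

Section exterior_derivative.
Context {R : realType} {n : nat}.
Notation E := 'rV[R]_n.
Notation dform := (@dform R n).
Implicit Types (phi psi : dform) (w : seq E -> R) (u v x : E) (vs : seq E).

(** On the full space the side conditions on tangent vectors disappear. *)
Lemma altformP w k : altform fullv k w <->
  [/\ forall vs, w vs <> 0 -> (size vs)%:Z = k,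
      forall a v v' vs1 vs2, w (vs1 ++ (a *: v + v') :: vs2) =
        a * w (vs1 ++ v :: vs2) + w (vs1 ++ v' :: vs2) &
      forall vs, ~~ uniq vs -> w vs = 0].
Proof.
have full vs : {subset vs <= (fullv : {vspace E})} by move=> v _; exact: memvf.
split=> [[H1 H2 H3]|[H1 H2 H3]]; split=> *.
- exact: (H1 _ (full _)).
- exact: (H2 _ _ _ _ _ (full _)).
- exact: (H3 _ (full _)).
- exact: H1.
- exact: H2.
- exact: H3.
Qed.

Definition multilinear w := forall a v v' vs1 vs2,
  w (vs1 ++ (a *: v + v') :: vs2) = a * w (vs1 ++ v :: vs2) + w (vs1 ++ v' :: vs2).

(** The form of the alternation axiom that passes through the recursion of the
    exterior derivative on the list of vectors. *)
Definition adjacent_alternating w := forall v vs1 vs2, w (vs1 ++ v :: v :: vs2) = 0.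

Lemma multilinear_cons w v : multilinear w -> multilinear (fun vs => w (v :: vs)).
Proof. by move=> wl a u u' vs1 vs2; exact: (wl _ _ _ (v :: vs1)). Qed.

Lemma adjacent_alternating_cons w v :
  adjacent_alternating w -> adjacent_alternating (fun vs => w (v :: vs)).
Proof. by move=> wl u vs1 vs2; exact: (wl _ (v :: vs1)). Qed.

Lemma uniq_adjacent_alternating w :
  (forall vs, ~~ uniq vs -> w vs = 0) -> adjacent_alternating w.
Proof.
move=> wu v vs1 vs2; apply: wu; rewrite cat_uniq !negb_and; apply/orP; right.
by apply/orP; right; rewrite /= mem_head.
Qed.

Lemma multilinearD w v v' vs1 vs2 : multilinear w ->
  w (vs1 ++ (v + v') :: vs2) = w (vs1 ++ v :: vs2) + w (vs1 ++ v' :: vs2).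
Proof. by move=> wl; rewrite -{1}[v]scale1r wl mul1r. Qed.

(** Polarisation: expand the value at two adjacent copies of u + v. *)
Lemma alternating_swap w u v vs1 vs2 :
    multilinear w -> adjacent_alternating w ->
  w (vs1 ++ u :: v :: vs2) = - w (vs1 ++ v :: u :: vs2).
Proof.
move=> wl wa; apply/eqP; rewrite -addr_eq0; apply/eqP.
have split2 c : w (vs1 ++ c :: (u + v) :: vs2) =
    w (vs1 ++ c :: u :: vs2) + w (vs1 ++ c :: v :: vs2).
  by rewrite -!(cat_rcons c) multilinearD.
have := wa (u + v) vs1 vs2; rewrite multilinearD// !split2 !wa.
by rewrite add0r addr0.
Qed.

(** Adjacent transpositions bring two equal vectors next to each other. *)
Lemma adjacent_alternating_uniq w vs :
  multilinear w -> adjacent_alternating w -> ~~ uniq vs -> w vs = 0.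
Proof.
move=> wl wa.
have repeat l1 v l2 l3 : w (l1 ++ v :: l2 ++ v :: l3) = 0.
  elim: l2 l1 => [|c l2 IH] l1 /=; first exact: wa.
  by rewrite alternating_swap// -cat_rcons IH oppr0.
suff main l1 : ~~ uniq vs -> w (l1 ++ vs) = 0 by exact: (main [::]).
elim: vs l1 => [//|v vs IH] l1 /=; rewrite negb_and negbK => /orP[|nu].
  by case/splitPr => l2 l3; exact: repeat.
by rewrite -cat_rcons IH.
Qed.

Lemma dsmooth_nil phi x : dsmooth phi x [::] = 0.
Proof. by rewrite /dsmooth big_ord0. Qed.

(** Cartan's formula: d phi contracted with a constant vector v is the
    derivative of phi along v minus d of the contraction. All properties of d
    below are proved by induction on the list of vectors with this recursion,
    the form being generalized because its contractions appear. *)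
Lemma dsmooth_cons phi x v vs : dsmooth phi x (v :: vs) =
  'D_v (phi^~ vs) x - dsmooth (fun y ws => phi y (v :: ws)) x vs.
Proof.
rewrite /dsmooth big_ord_recl/= expr0 mul1r drop0; congr (_ + _).
rewrite -sumrN; apply: eq_bigr => i _ /=.
by rewrite exprS mulN1r mulNr.
Qed.

Definition smooth_coefs phi := forall vs, smooth (phi^~ vs).

Lemma smooth_coefs_cons phi v :
  smooth_coefs phi -> smooth_coefs (fun y ws => phi y (v :: ws)).
Proof. by move=> sphi vs; exact: (sphi (v :: vs)). Qed.

Lemma smooth_coefs_derive phi v :
  smooth_coefs phi -> smooth_coefs (fun y ws => 'D_v (phi^~ ws) y).
Proof. by move=> sphi vs; apply: (smooth_derive v (sphi vs)). Qed.

Lemma smooth_affine a f g : smooth f -> smooth g ->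
  smooth (fun y : E => a * f y + g y).
Proof.
move=> sf sg; have -> : (fun y : E => a * f y + g y) = cst a * f + g by [].
by apply: smoothD => //; apply: smoothM => //; exact: smooth_cst.
Qed.

Lemma derive_affine a f g v x : smooth f -> smooth g ->
  'D_v (fun y : E => a * f y + g y) x = a * 'D_v f x + 'D_v g x.
Proof.
move=> sf sg; have -> : (fun y : E => a * f y + g y) = a \*: f + g by [].
rewrite deriveD; last 2 first.
- by apply: derivableZ; exact: smooth_derivable.
- exact: smooth_derivable.
by rewrite deriveZ//; exact: smooth_derivable.
Qed.

Lemma dsmooth_affine a phi psi x vs : smooth_coefs phi -> smooth_coefs psi ->
  dsmooth (fun y ws => a * phi y ws + psi y ws) x vs =
  a * dsmooth phi x vs + dsmooth psi x vs.
Proof.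
elim: vs phi psi => [|v vs IH] phi psi sphi spsi.
  by rewrite !dsmooth_nil mulr0 addr0.
rewrite !dsmooth_cons derive_affine//.
rewrite (IH (fun y ws => phi y (v :: ws)) (fun y ws => psi y (v :: ws)));
  [|exact: smooth_coefs_cons..].
by rewrite mulrBr opprD addrACA.
Qed.

Lemma smooth_coefs_dsmooth phi : smooth_coefs phi -> smooth_coefs (dsmooth phi).
Proof.
move=> + vs; elim: vs phi => [|v vs IH] phi sphi.
  have -> : (dsmooth phi)^~ [::] = cst 0 by apply/funext => x; rewrite dsmooth_nil.
  exact: smooth_cst.
have -> : (dsmooth phi)^~ (v :: vs) =
    'D_v (phi^~ vs) - (dsmooth (fun y ws => phi y (v :: ws)))^~ vs.
  by apply/funext => x; rewrite dsmooth_cons.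
apply: smoothB; first exact/smooth_derive/sphi.
exact/IH/smooth_coefs_cons.
Qed.

(** The Lie derivative along a constant field commutes with d; this is where
    the symmetry of second derivatives enters. *)
Lemma derive_dsmooth phi x v vs : smooth_coefs phi ->
  'D_v ((dsmooth phi)^~ vs) x = dsmooth (fun y ws => 'D_v (phi^~ ws) y) x vs.
Proof.
elim: vs phi x => [|w vs IH] phi x sphi.
  rewrite dsmooth_nil.
  have -> : (dsmooth phi)^~ [::] = cst 0 by apply/funext => y; rewrite dsmooth_nil.
  by rewrite derive_cst.
have sphiw : smooth_coefs (fun y ws => phi y (w :: ws)) by exact: smooth_coefs_cons.
rewrite dsmooth_cons -[X in _ = _ - X](IH (fun y ws => phi y (w :: ws)))//.
have -> : (dsmooth phi)^~ (w :: vs) =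
    'D_w (phi^~ vs) - (dsmooth (fun y ws => phi y (w :: ws)))^~ vs.
  by apply/funext => y; rewrite dsmooth_cons.
rewrite deriveB; last 2 first.
- by apply: smooth_derivable; apply: smooth_derive; exact: sphi.
- by apply: smooth_derivable; apply: smooth_coefs_dsmooth.
by rewrite (schwarz v w x (sphi vs)).
Qed.

(** Contracting with the first vector v and using the recursion twice, d d phi
    becomes the Lie derivative of d phi minus d of the Lie derivative of phi,
    up to d d of a contraction of phi, which vanishes by induction. *)
Theorem dsmooth_dsmooth phi x vs :
  smooth_coefs phi -> dsmooth (dsmooth phi) x vs = 0.
Proof.
elim: vs phi x => [|v vs IH] phi x sphi; first by rewrite dsmooth_nil.
have sphiv : smooth_coefs (fun y ws => phi y (v :: ws)) by exact: smooth_coefs_cons.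
rewrite dsmooth_cons derive_dsmooth//.
have -> : (fun y ws => dsmooth phi y (v :: ws)) =
    (fun y ws => -1 * dsmooth (fun y ws => phi y (v :: ws)) y ws
                 + 'D_v (phi^~ ws) y).
  by apply/funext => y; apply/funext => ws; rewrite dsmooth_cons mulN1r addrC.
rewrite dsmooth_affine; last 2 first.
- exact: smooth_coefs_dsmooth.
- exact: smooth_coefs_derive.
by rewrite IH// mulr0 add0r subrr.
Qed.

Lemma dsmooth_multilinear phi x : smooth_coefs phi ->
  (forall y, multilinear (phi y)) -> multilinear (dsmooth phi x).
Proof.
move=> sphi lphi a v v' vs1 vs2.
elim: vs1 phi sphi lphi => [|c vs1 IH] phi sphi lphi.
  rewrite !cat0s !dsmooth_cons.
  have -> : (fun y ws => phi y ((a *: v + v') :: ws)) =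
      (fun y ws => a * phi y (v :: ws) + phi y (v' :: ws)).
    by apply/funext => y; apply/funext => ws; rewrite (lphi y a v v' [::]).
  rewrite dsmooth_affine; [|exact: smooth_coefs_cons..].
  rewrite mulrBr opprD addrACA; congr (_ + _).
  have dphi := smooth_differentiable x (sphi vs2).
  by rewrite !(deriveE _ dphi) linearP.
rewrite !cat_cons !dsmooth_cons.
rewrite (IH (fun y ws => phi y (c :: ws))); last 2 first.
- exact: smooth_coefs_cons.
- by move=> y; exact: multilinear_cons.
have -> : phi^~ (vs1 ++ (a *: v + v') :: vs2) =
    (fun y => a * phi y (vs1 ++ v :: vs2) + phi y (vs1 ++ v' :: vs2)).
  by apply/funext => y; rewrite lphi.
rewrite derive_affine; [|exact: sphi..].
by rewrite mulrBr opprD addrACA.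
Qed.

Lemma dsmooth_alternating phi x :
  (forall y, adjacent_alternating (phi y)) -> smooth_coefs phi ->
  adjacent_alternating (dsmooth phi x).
Proof.
move=> aphi sphi v vs1 vs2; elim: vs1 phi aphi sphi => [|c vs1 IH] phi aphi sphi.
  rewrite !cat0s !dsmooth_cons.
  have -> : (fun y ws => phi y [:: v, v & ws]) = (fun y ws => -1 * 0 + 0).
    by apply/funext => y; apply/funext => ws; rewrite (aphi y v [::]) mulr0 addr0.
  rewrite dsmooth_affine; [|by move=> ?; exact: smooth_cst..].
  rewrite mulN1r addNr subr0 subrr//.
rewrite cat_cons dsmooth_cons IH.
- have -> : phi^~ (vs1 ++ [:: v, v & vs2]) = cst 0.
    by apply/funext => y; rewrite aphi.
  by rewrite derive_cst subr0.
- by move=> y; exact: adjacent_alternating_cons.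
- exact: smooth_coefs_cons.
Qed.

Lemma smooth_form_dsmooth k phi :
  smooth_form k phi -> smooth_form (k + 1) (dsmooth phi).
Proof.
move=> [aphi sphi]; split=> [x|]; last exact: smooth_coefs_dsmooth.
have lphi y : multilinear (phi y) by have /altformP[] := aphi y.
have alphi y : adjacent_alternating (phi y).
  by apply: uniq_adjacent_alternating; have /altformP[] := aphi y.
have ldphi := dsmooth_multilinear x sphi lphi.
apply/altformP; split => //.
- move=> vs; apply: contra_notP => /eqP szk; rewrite /dsmooth big1// => i _.
  have -> : (fun y => phi y (take i vs ++ drop i.+1 vs)) = cst 0.
    apply/funext => y /=; apply/eqP; apply: contraNT szk => /eqP nz.
    have /altformP[H _ _] := aphi y; rewrite -(H _ nz) size_cat size_drop.
    rewrite size_takel; last exact: ltnW.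
    by rewrite -PoszD addn1 -addSn subnKC.
  by rewrite derive_cst mulr0.
- move=> vs; apply: adjacent_alternating_uniq => //.
  exact: dsmooth_alternating.
Qed.

Lemma vanishes_near_dsmooth (S : set E) phi :
  vanishes_near S phi -> vanishes_near S (dsmooth phi).
Proof.
move=> [U [oU SU U0]]; exists U; split => // x vs Ux.
rewrite /dsmooth big1// => i _.
have -> : 'D_(vs`_i) (fun y => phi y (take i vs ++ drop i.+1 vs)) x =
    'D_(vs`_i) (cst 0 : E -> R) x.
  apply: near_eq_derive; have : nbhs x U by exact: open_nbhs_nbhs.
  by apply: filterS => y Uy; rewrite U0.
by rewrite derive_cst mulr0.
Qed.

(** The homotopy formula for the Koszul operator on constant forms: since a
    constant form is closed, d of its contraction with the field x - b is the
    form multiplied by its degree. *)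
Lemma dsmooth_koszul (a : seq E -> R) (b x : E) vs :
    multilinear a -> adjacent_alternating a ->
  dsmooth (fun y ws => a ((y - b) :: ws)) x vs = (size vs)%:R * a vs.
Proof.
elim: vs a => [|v vs IH] a la aa; first by rewrite dsmooth_nil mul0r.
rewrite dsmooth_cons.
have lin ws : scalar_linear (fun y => a (y :: ws)).
  by move=> c y y'; rewrite (la c y y' [::]).
have shift ws y : a ((y - b) :: ws) = 1 * a (y :: ws) + cst (- a (b :: ws)) y.
  by rewrite mul1r addrC -(scaleN1r b) lin mulN1r addrC.
have sa ws := smooth_scalar_linear (lin ws).
have -> : (fun y => a ((y - b) :: vs)) =
    (fun y => 1 * a (y :: vs) + cst (- a (b :: vs)) y) by apply/funext => y.
rewrite derive_affine//; last exact: smooth_cst.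
rewrite derive_cst addr0 mul1r derive_scalar_linear//.
have -> : (fun y ws => a [:: y - b, v & ws]) =
    (fun y ws => -1 * a [:: v, y - b & ws] + 0).
  apply/funext => y; apply/funext => ws; rewrite addr0 mulN1r.
  exact: (@alternating_swap a (y - b) v [::]).
have sk : smooth_coefs (fun y ws => a [:: v, y - b & ws]).
  move=> ws; have -> : (fun y => a [:: v, y - b & ws]) =
      (fun y => -1 * a (y :: v :: ws) + cst (a (b :: v :: ws)) y).
    apply/funext => y; rewrite -[LHS]opprK -(@alternating_swap a _ _ [::])// shift.
    by rewrite mul1r mulN1r opprD opprK.
  by apply: smooth_affine => //; exact: smooth_cst.
rewrite dsmooth_affine//; last by move=> ?; exact: smooth_cst.
rewrite (IH (fun ws => a (v :: ws))); last 2 first.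
- exact: multilinear_cons.
- exact: adjacent_alternating_cons.
have -> : dsmooth (fun=> fun=> 0) x vs = 0 :> R.
  by rewrite /dsmooth big1// => i _; rewrite derive_cst mulr0.
by rewrite addr0 mulN1r opprK -natr1 mulrDl mul1r addrC.
Qed.

End exterior_derivative.

(** * Flat functions *)

Section flat_functions.
Context {R : realType}.
Implicit Types (p : {poly R}) (s t h : R).

(** For p = 1 this is the function equal to exp(-1/t) for positive t and to 0
    elsewhere; the polynomial factor in 1/t makes the family stable under
    differentiation. *)
Definition flat p t : R := if 0 < t then p.[t^-1] * expR (- t^-1) else 0.

Lemma flat_gt0 p t : 0 < t -> flat p t = p.[t^-1] * expR (- t^-1).
Proof. by rewrite /flat => ->. Qed.

Lemma flat_le0 p t : t <= 0 -> flat p t = 0.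
Proof. by rewrite /flat ltNge => ->. Qed.

(** The exponential series beats every power of 1/t, so that flat functions
    have a zero of order at least two at the origin, and so a zero derivative
    there. *)
Lemma flat_near0 p :
  exists2 K, 0 < K & forall h, h < 1 -> `|flat p h| <= K * h ^+ 2.
Proof.
pose C := 1 + \sum_(i < size p) `|p`_i|.
have C0 : 0 < C by rewrite ltr_pwDl// sumr_ge0.
exists (C * (size p).+2`!%:R) => [|h h1]; first by rewrite mulr_gt0// ltr0n fact_gt0.
have [h0|h0] := leP h 0.
  by rewrite flat_le0// normr0 mulr_ge0// ?sqr_ge0// mulr_ge0// ltW.
rewrite flat_gt0//; set s := h^-1.
have s1 : 1 <= s by rewrite invf_ge1// ltW.
have s0 : 0 < s := lt_le_trans ltr01 s1.
have ps : `|p.[s]| <= C * s ^+ size p.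
  rewrite horner_coef /C mulrDl mulr_suml; apply: (le_trans (ler_norm_sum _ _ _)).
    apply: ler_wpDl; first by rewrite mul1r exprn_ge0// ltW.
  apply: ler_sum => i _; rewrite normrM ler_wpM2l// ger0_norm.
    by rewrite ler_weXn2l// ltnW.
  by rewrite exprn_ge0// ltW.
have es : expR (- s) <= (size p).+2`!%:R / s ^+ (size p).+2.
  rewrite expRN -[_ / _]invrK lef_pV2 ?posrE ?expR_gt0//; last first.
    by rewrite invr_gt0 divr_gt0// ?exprn_gt0// ltr0n fact_gt0.
  rewrite invf_div; apply: le_trans (expR_ge1Dxn (size p).+1 (ltW s0)).
  by rewrite lerDr.
rewrite normrM (ger0_norm (expR_ge0 _)).
apply: (le_trans (ler_pM _ (expR_ge0 _) ps es)); first exact: normr_ge0.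
have sN0 : s != 0 by rewrite gt_eqF.
rewrite (_ : C * _ * _ = C * (size p).+2`!%:R * h ^+ 2)//.
rewrite (_ : h = s^-1); last by rewrite /s invrK.
have sN : s ^+ size p != 0 by rewrite expf_neq0.
move: ((size p).+2`!%:R) => c; rewrite -addn2 exprD.
by field; rewrite sN0.
Qed.

(** The chain rule for t > 0, where d(1/t) contributes the factor -1/t^2; at t
    = 0 the difference quotient is bounded by a multiple of |t|. *)
Lemma is_derive_flat p t : is_derive t 1 (flat p) (flat ('X^2 * (p - p^`())) t).
Proof.
have [t0|t0|->] := ltgtP t 0.
- rewrite flat_le0 ?ltW//; apply: (@near_eq_is_derive _ _ _ (cst 0)).
  near=> z; rewrite flat_le0// ltW//; near: z; exact: lt_nbhsl.
- have tn0 : t != 0 by rewrite gt_eqF.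
  apply: (@near_eq_is_derive _ _ _ ((horner p \o GRing.inv) * (expR \o (- GRing.inv)))).
    by near=> z; rewrite flat_gt0// -oppr_lt0; near: z; apply: Nlt_nbhsl; rewrite oppr_lt0.
  have dinv : is_derive t (1:R) (GRing.inv : R -> R) (- t ^- 2).
    have := @is_deriveV _ id t 1 1 tn0 (is_derive_id t 1).
    by rewrite /= [_ *: _]mulr1.
  rewrite flat_gt0//.
  have dp := @is_derive1_comp _ (horner p) GRing.inv t _ _ (is_derive_poly p t^-1) dinv.
  have de := @is_derive1_comp _ expR (- GRing.inv) t _ _
    (is_derive_expR (- t^-1)) (is_deriveN dinv).
  apply: is_derive_eq (is_deriveM dp de) _.
  rewrite opprK !hornerE /=.
  rewrite -![_ *: _]/(_ * _) exprVn.
  set P := p.[_]; set Q := (_^`()).[_]; set e := expR _; set T := t ^- 2.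
  by ring.
- rewrite flat_le0//; have [K K_gt0 HK] := flat_near0 p.
  suff H : (fun h : R => h^-1 *: (flat p (h *: (1:R) + 0) - flat p 0)) @ 0^' --> (0 : R).
    split; first by apply/cvg_ex; exists 0.
    by apply: cvg_lim.
  rewrite flat_le0//.
  apply/cvgr0Pnorm_le => e e0; near=> h.
  have hn0 : h != 0 by near: h; exact: nbhs_dnbhs_neq.
  rewrite subr0 addr0 [h *: _]mulr1 normrZ normfV.
  rewrite ler_pdivrMl ?normr_gt0//.
  have h1 : h < 1.
    apply: le_lt_trans (ler_norm h) _; near: h.
    by apply: dnbhs0_lt; exact: ltr01.
  apply: (le_trans (HK _ h1)); rewrite -real_normK ?num_real// expr2 mulrA mulrC.
  rewrite ler_pM2l ?normr_gt0//.
  rewrite -ler_pdivlMl//; near: h.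
  apply: dnbhs0_le; rewrite mulr_gt0// invr_gt0//.
Unshelve. all: by end_near. Qed.

Lemma flat1 t : 0 < t -> flat 1 t = expR (- t^-1).
Proof. by move=> t0; rewrite flat_gt0// hornerC mul1r. Qed.

Lemma flat1_ge0 t : 0 <= flat 1 t.
Proof.
have [t0|t0] := leP t 0; first by rewrite flat_le0.
by rewrite flat1// expR_ge0.
Qed.

Lemma flat1_le1 t : flat 1 t <= 1.
Proof.
have [t0|t0] := leP t 0; first by rewrite flat_le0.
by rewrite flat1// expR_le1 oppr_le0 invr_ge0 ltW.
Qed.

(** Dilating the argument turns the flat function into an approximation of the
    indicator of the positive half-line, with the same support. *)
Lemma cvg_flat1 t : 0 < t -> flat 1 (j.+1%:R * t) @[j --> \oo] --> (1 : R).
Proof.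
move=> t0; rewrite -[X in _ --> X]expR0.
have -> : (fun j => flat 1 (j.+1%:R * t)) = (fun j => expR (- (t^-1 * j.+1%:R^-1))).
  by apply/funext => j; rewrite flat1 ?mulr_gt0// invfM mulrC.
apply: continuous_cvg; first exact: continuous_expR.
rewrite -[X in _ --> X]oppr0 -(mulr0 t^-1); apply: cvgN; apply: cvgM; first exact: cvg_cst.
exact: cvg_harmonic.
Qed.

End flat_functions.

Section bump.
Context {R : realType} {n : nat}.
Notation E := 'rV[R]_n.

Lemma derive_comp1 (g dg : R -> R) (f : E -> R) (v x : E) :
    (forall t : R, is_derive t 1 g (dg t)) -> differentiable f x ->
  differentiable (g \o f) x /\ 'D_v (g \o f) x = dg (f x) * 'D_v f x.
Proof.
move=> gdg df; have [dgx Dgx] := gdg (f x).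
have dg' : differentiable g (f x) by exact/derivable1_diffP.
have dgf : differentiable (g \o f) x by exact: differentiable_comp.
split => //; rewrite !deriveE// diff_comp//= -Dgx deriveE//.
by rewrite -[X in 'd g _ X]mulr1 [LHS]linearZ mulrC.
Qed.

Lemma smooth_flat (l : E -> R) (a c : R) p : scalar_linear l ->
  smooth (fun x => flat p (a * l x + c)).
Proof.
move=> ll.
pose F q x := flat q (a * l x + c).
apply: (@generated_smooth _ _ (fun f => exists q, f = F q)); last first.
  by apply: gen_base; exists p.
move=> _ [q ->].
have sl : smooth (fun x : E => a * l x + c).
  by apply: smooth_affine; [exact: smooth_scalar_linear|exact: smooth_cst].
have key v x := derive_comp1 v (is_derive_flat q) (smooth_differentiable x sl).
split=> [x|v]; first by have [] := key 0 x.
have -> : 'D_v (F q) = F ('X^2 * (q - q^`())) * cst (a * l v).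
  apply/funext => x; have [_ ->] := key v x; congr (_ * _).
  rewrite derive_affine; [|exact: smooth_scalar_linear|exact: smooth_cst].
  by rewrite derive_cst addr0 derive_scalar_linear.
by apply: gen_mul; [apply: gen_base; eexists|exact: gen_cst].
Qed.

End bump.

(** * Null sets and boxes *)

Section integral_null.
Context d (X : measurableType d) (R : realType) (mu : {measure set X -> \bar R}).
Local Open Scope ereal_scope.
Import HBNNSimple.

(** The integral of a nonnegative function is a supremum over the measurable
    simple functions below it, and each of these vanishes off the null set;
    hence f itself may fail to be measurable. This matters because the
    integrands met below are products with forms subject to no measurability
    condition. *)
Lemma ge0_integral_null (f : X -> \bar R) : (forall x, 0 <= f x) ->
  mu.-negligible [set x | f x != 0] -> \int[mu]_x f x = 0.
Proof.
move=> f0 [N [mN N0 fN]]; apply/eqP; rewrite eq_le; apply/andP; split; last first.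
  by apply: integral_ge0 => x _.
rewrite ge0_integralTE//; apply: ge_ereal_sup => _ [h /= hf <-].
rewrite -integralT_nnsfun.
rewrite (ge0_negligible_integral mN)//; last first.
- by move=> x _; rewrite lee_fin.
- exact/measurable_EFinP.
rewrite integral0_eq// => x [_ Nx]; apply/eqP; rewrite eq_le.
rewrite [X in _ && X]lee_fin fun_ge0 andbT; apply: (le_trans (hf x)).
by rewrite leNgt; apply/negP => fx; apply/Nx/fN => /=; rewrite gt_eqF.
Qed.

Lemma integral_null D (f : X -> \bar R) :
  mu.-negligible [set x | D x /\ f x != 0] -> \int[mu]_(x in D) f x = 0.
Proof.
move=> fN; rewrite integral_mkcond integralE !ge0_integral_null ?sube0//.
- apply: negligibleS fN => x /=; rewrite funenegE patchE.
  case: ifPn => [/set_mem Dx|_]; last by rewrite oppe0 maxxx eqxx.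
  by move=> fx; split => //; apply: contraNneq fx => ->; rewrite oppe0 maxxx.
- apply: negligibleS fN => x /=; rewrite funeposE patchE.
  case: ifPn => [/set_mem Dx|_]; last by rewrite maxxx eqxx.
  by move=> fx; split => //; apply: contraNneq fx => ->; rewrite maxxx.
Qed.

Lemma Rintegral_null D (f : X -> R) :
  mu.-negligible [set x | D x /\ f x != 0%R] -> (\int[mu]_(x in D) f x)%R = 0%R.
Proof.
move=> fN; rewrite /Rintegral integral_null//.
Qed.

End integral_null.

Section boxes.
Context {R : realType} {d : nat}.
Notation Rd := (d.-tuple (measurableTypeR R)).
Implicit Types (a b y z : d.-tuple R).

Definition box a b : set Rd := [set y | forall i, tnth a i < tnth y i < tnth b i].

Definition closed_box a b : set Rd :=
  [set y | forall i, tnth a i <= tnth y i <= tnth b i].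

Lemma measurable_box a b : measurable (box a b).
Proof.
have -> : box a b = \bigcap_(i in [set: 'I_d])
    ((fun y : Rd => tnth y i) @^-1` `]tnth a i, tnth b i[%classic).
  apply/seteqP; split=> [y ab i _|y ab i] /=; first by rewrite in_itv/=.
  by have := ab i I; rewrite /= in_itv.
apply: fin_bigcap_measurable => // i _; rewrite -[X in measurable X]setTI.
by apply: measurable_tnth => //; exact: measurable_itv.
Qed.

Lemma boxI a b a' b' : box a b `&` box a' b' =
  box [tuple Num.max (tnth a i) (tnth a' i) | i < d]
      [tuple Num.min (tnth b i) (tnth b' i) | i < d].
Proof.
apply/seteqP; split=> [y [ab ab'] i|y ab].
  have /andP[a1 b1] := ab i; have /andP[a2 b2] := ab' i.
  rewrite !tnth_mktuple gt_max lt_min.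
  by apply/andP; split; apply/andP; split; [exact: a1|exact: a2|exact: b1|exact: b2].
by split=> i; have := ab i; rewrite !tnth_mktuple gt_max lt_min;
  move=> /andP[/andP[a1 a2] /andP[b1 b2]]; apply/andP; split.
Qed.

Definition boxes : set (set Rd) :=
  [set box ab.1 ab.2 | ab in [set: d.-tuple R * d.-tuple R]].

Lemma exists_nat_tuple_bound y : exists k : nat, forall i, `|tnth y i| < k%:R.
Proof.
exists (Num.truncn (\sum_i `|tnth y i|)).+1 => i.
apply: le_lt_trans (truncnS_gt _).
by rewrite (bigD1 i)//= lerDl sumr_ge0.
Qed.

(** The coordinate maps are measurable for the sigma-algebra of boxes, since
    the preimage of an interval is a countable union of boxes. *)
Lemma measurable_tuple_boxes : @measurable _ Rd = <<s boxes >>.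
Proof.
apply/seteqP; split; last first.
  by apply: smallest_sub; [exact: sigma_algebra_measurable|
     move=> _ [[a b] _ <-]; exact: measurable_box].
pose Bd := g_sigma_algebraType boxes.
suff : measurable_fun [set: Bd] (fun y : Bd => y : Rd).
  by move=> mid A mA; have := mid measurableT A mA; rewrite setTI.
apply/measurable_fun_tnthP => i.
apply: (measurability _ (RGenOpens.measurableE R)).
move=> _ [_ [x [y ->]] <-]; rewrite setTI.
pose lo (k : nat) : d.-tuple R := [tuple if j == i then x else - k%:R | j < d].
pose hi (k : nat) : d.-tuple R := [tuple if j == i then y else k%:R | j < d].
rewrite [X in measurable X](_ : _ = \bigcup_k (box (lo k) (hi k) : set Bd)).
  apply: bigcupT_measurable => k; apply: sub_sigma_algebra.
  by exists (lo k, hi k).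
apply/seteqP; split=> [z /=|z [k _ /(_ i)]].
  rewrite in_itv/= => xzy; have [k kz] := exists_nat_tuple_bound z.
  exists k => // j; rewrite !tnth_mktuple; case: eqP => [->//|_].
  by have := kz j; rewrite ltr_norml.
by rewrite !tnth_mktuple eqxx /= in_itv.
Qed.

(** The pi-lambda theorem: the measurable sets over whose trace on the box f
    has integral zero form a Dynkin system, and boxes are stable under
    intersection. Only sub-boxes of the closed box are tested because test
    functions must have their support inside a prescribed open set. *)
Lemma ae0_of_boxes (mu : {measure set Rd -> \bar R}) a b (f : Rd -> R) :
    mu.-integrable (box a b) (EFin \o f) ->
    (forall a' b', closed_box a' b' `<=` closed_box a b ->
       (\int[mu]_(y in box a' b') (f y)%:E = 0)%E) ->
  mu.-negligible [set y | box a b y /\ f y != 0].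
Proof.
move=> fi f0; set Q := box a b.
have mQ : measurable Q := measurable_box a b.
have mf : measurable_fun Q (EFin \o f) := measurable_int _ fi.
have key A : measurable A -> (\int[mu]_(y in A `&` Q) (f y)%:E = 0)%E.
  rewrite measurable_tuple_boxes; move: A.
  apply: (@dynkin_induction _ _ boxes
    (fun A : set Rd => (\int[mu]_(y in A `&` Q) (f y)%:E = 0)%E)).
  - exact: measurable_tuple_boxes.
  - move=> _ _ [[a1 b1] _ <-] [[a2 b2] _ <-] /=; rewrite boxI.
    by eexists (_, _).
  - by rewrite setTI; exact: f0.
  - move=> _ [[a1 b1] _ <-] /=; rewrite boxI f0// => y yab i.
    have := yab i; rewrite !tnth_mktuple ge_max le_min.
    by move=> /andP[/andP[_ ay] /andP[_ yb]]; apply/andP; split.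
  - move=> S mS S0; have : (\int[mu]_(y in Q) (f y)%:E = 0)%E by exact: f0.
    have QS : Q = (S `&` Q) `|` (~` S `&` Q) by rewrite -setIUl setUv setTI.
    rewrite {1}QS integral_setU.
    + by rewrite S0 add0e.
    + exact: measurableI.
    + by apply: measurableI => //; exact: measurableC.
    + by rewrite -QS.
    + by apply/disj_setPS => y [[? _] []].
  - move=> F mF tF F0; rewrite setI_bigcupl integral_bigcup.
    + by rewrite eseries0.
    + by apply: trivIset_setIr.
    + by move=> k; exact: measurableI.
    + rewrite -setI_bigcupl; apply: integrableS fi => //.
      by apply: measurableI => //; exact: bigcupT_measurable.
have : ae_eq mu Q (EFin \o f) (cst 0%E).
  apply: integral_ae_eq => //= A AQ mA.
  by rewrite integral0 -(key _ mA) setIidl.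
apply: negligibleS => y [Qy fy] /= /(_ Qy) [] /eqP.
by rewrite (negPf fy).
Qed.

(** Openness for the maximum norm, in the form that yields a covering by
    countably many rational boxes, and with it measurability. *)
Definition sup_open (D : set Rd) := forall y : Rd, D y ->
  exists2 e : R, 0 < e & forall z : Rd,
    (forall i, `|(tnth z i : R) - tnth y i| < e) -> D z.

Lemma sup_open_boxes (D : set Rd) : sup_open D ->
  D = \bigcup_(q in [set q : d.-tuple rat * d.-tuple rat |
        closed_box [tuple ratr (tnth q.1 i) | i < d] [tuple ratr (tnth q.2 i) | i < d]
          `<=` D])
      box [tuple ratr (tnth q.1 i) | i < d] [tuple ratr (tnth q.2 i) | i < d].
Proof.
move=> oD; apply/seteqP; split=> [y Dy|y [q qD qy]]; last first.
  by apply: qD => i; have /andP[? ?] := qy i; rewrite !ltW.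
have [e e0 De] := oD y Dy.
have lo i : {q : rat | tnth y i - e < ratr q < tnth y i}.
  apply: cid; have [|q] := @rat_in_itvoo R (tnth y i - e) (tnth y i).
    by rewrite ltrBlDr ltrDl.
  by rewrite in_itv/= => qy; exists q.
have hi i : {q : rat | tnth y i < ratr q < tnth y i + e}.
  apply: cid; have [|q] := @rat_in_itvoo R (tnth y i) (tnth y i + e).
    by rewrite ltrDl.
  by rewrite in_itv/= => qy; exists q.
exists ([tuple sval (lo i) | i < d], [tuple sval (hi i) | i < d]) => /= [z zlh|i].
  apply: De => i; have := zlh i; rewrite !tnth_mktuple.
  move: (svalP (lo i)) (svalP (hi i)) => /andP[p1 p2] /andP[q1 q2] /andP[pz zq].
  by rewrite ltr_distl (lt_le_trans p1 pz) (le_lt_trans zq q2).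
rewrite !tnth_mktuple.
by move: (svalP (lo i)) (svalP (hi i)) => /andP[_ ->] /andP[-> _].
Qed.

Lemma measurable_sup_open (D : set Rd) : sup_open D -> measurable D.
Proof.
move=> /sup_open_boxes ->; rewrite bigcup_mkcond.
apply: countable_bigcupT_measurable; first exact: countableP.
by move=> q; case: ifP => // _; exact: measurable_box.
Qed.

(** An open set is a countable union of rational boxes whose closures it
    contains, so that being null is a local property. *)
Lemma negligible_sup_open (mu : {measure set Rd -> \bar R}) (D : set Rd) (f : Rd -> R) :
    sup_open D ->
    (forall a b, closed_box a b `<=` D -> mu.-negligible [set y | box a b y /\ f y != 0]) ->
  mu.-negligible [set y | D y /\ f y != 0].
Proof.
move=> /sup_open_boxes Db Hf.
pose B (k : nat) : set Rd := if unpickle k is Some q then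
   let lo := [tuple ratr (tnth q.1 i) | i < d] in
   let hi := [tuple ratr (tnth q.2 i) | i < d] : d.-tuple R in
   if `[< closed_box lo hi `<=` D >] then [set y | box lo hi y /\ f y != 0] else set0
   else set0.
apply: (@negligibleS _ _ _ mu (\bigcup_k B k)); last first.
  apply: negligible_bigcup => k; rewrite /B; case: unpickle => [q|] /=.
    by case: asboolP => [/Hf//|_]; exact: negligible_set0.
  exact: negligible_set0.
move=> y [Dy fy]; move: (Dy); rewrite {1}Db => -[q /= qD qy].
exists (pickle q) => //; rewrite /B pickleK /=.
by case: asboolP.
Qed.

End boxes.

Section lebesgue_nd.
Context {R : realType}.

Lemma lebesgue_nd_box d (a b : d.-tuple R) : (lebesgue_nd d (box a b) < +oo)%E.
Proof.
elim: d a b => [|d IH] a b.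
  by rewrite /= diracE; case: (_ \in _); rewrite ltry.
rewrite /= /lebesgueS /pushforward.
have -> : @tcons R d @^-1` box a b =
    `]thead a, thead b[%classic `*` box [tuple of behead a] [tuple of behead b].
  apply/seteqP; split=> [[x y] /= H|[x y] /= [+ H] i].
    split; first by have := H ord0; rewrite /= in_itv.
    move=> i; have := H (lift ord0 i).
    by rewrite !(tnth_nth 0) /= !nth_behead.
  rewrite in_itv /= => xab; have [->//|i0] := eqVneq i ord0.
  have i1 : (i.-1 < d)%N by rewrite prednK ?lt0n// -ltnS.
  have := H (Ordinal i1); rewrite !(tnth_nth 0)/= !nth_behead.
  have -> : nth 0 (x :: y) i = nth 0 y i.-1.
    by rewrite -[in LHS](@prednK i) ?lt0n.
  by rewrite prednK// lt0n.
rewrite product_measure1E//; last exact: measurable_box.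
apply: lte_mul_pinfty => //.
rewrite ge0_fin_numE//= lebesgue_measure_itv.
by case: ifP => _; rewrite ?ltry// -EFinB ltry.
Qed.

(** On a set of finite measure |f| is dominated by 1 + f^2. *)
Lemma square_integrable_box d (D : set (d.-tuple (measurableTypeR R)))
    (f : d.-tuple (measurableTypeR R) -> R) a b :
    measurable D -> measurable_fun D f ->
    (lebesgue_nd d).-integrable D (fun y => (f y ^+ 2)%:E) ->
    box a b `<=` D ->
  (lebesgue_nd d).-integrable (box a b) (EFin \o f).
Proof.
move=> mD mf f2 abD; have mQ := @measurable_box R d a b.
have i1 : (lebesgue_nd d).-integrable (box a b) (cst 1%E).
  apply: (@measurable_bounded_integrable _ _ _ _ (cst 1)) => //.
    exact: lebesgue_nd_box.
  by exists 1; split; rewrite ?num_real// => M M1 x _ /=; rewrite normr1 ltW.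
have mfQ : measurable_fun (box a b) f by exact: measurable_funS mD abD mf.
apply: (@le_integrable _ _ _ _ _ mQ _ (fun y => 1 + (f y ^+ 2)%:E)%E).
- exact/measurable_EFinP.
- move=> y Qy; rewrite -EFinD /= lee_fin (ger0_norm (addr_ge0 _ (sqr_ge0 _)))//.
  rewrite -real_normK ?num_real//; set t := `|f y|.
  have := sqr_ge0 (t - 1); have := normr_ge0 (f y); rewrite -/t; nra.
- apply: integrableD => //.
  by apply: integrableS f2 => //.
Qed.

End lebesgue_nd.

(** * Approximating the indicator of a box *)

Section box_bump.
Context {R : realType} {d : nat}.
Notation Rd := (d.-tuple (measurableTypeR R)).
Implicit Types (a b : d.-tuple R).

(** As j grows this tends pointwise to the indicator of the open box, while
    its support stays inside the closed box. *)
Definition box_bump a b (j : nat) (y : 'I_d -> R) : R :=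
  \prod_(i < d) (flat 1 (j.+1%:R * (y i - tnth a i)) *
                 flat 1 (j.+1%:R * (tnth b i - y i))).

Lemma box_bump_ge0_le1 a b j y : 0 <= box_bump a b j y <= 1.
Proof.
apply/andP; split.
  by apply: prodr_ge0 => i _; rewrite mulr_ge0// flat1_ge0.
rewrite (_ : 1 = \prod_(i < d) (1 : R)); last by rewrite big1.
apply: ler_prod => i _; rewrite mulr_ge0 ?flat1_ge0//=.
by rewrite mulr_ile1// ?flat1_ge0// flat1_le1.
Qed.

Lemma box_bump_eq0 a b j y i :
  (y i <= tnth a i) || (tnth b i <= y i) -> box_bump a b j y = 0.
Proof.
move=> yab; apply/eqP/prodf_eq0; exists i => //; rewrite mulf_eq0.
by apply/orP; case/orP: yab => yi; [left|right]; rewrite flat_le0//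
  pmulr_rle0// subr_le0.
Qed.

Lemma cvg_box_bump a b (y : Rd) : box a b y ->
  box_bump a b j (tnth y) @[j --> \oo] --> (1 : R).
Proof.
move=> ab; have -> : (1 : R) = \prod_(i < d) 1 by rewrite big1.
apply: cvg_big => [|i _]; first exact: mul_continuous.
have /andP[ai bi] := ab i.
rewrite -[X in _ --> X](mulr1 1).
by apply: cvgM; apply: cvg_flat1; rewrite subr_gt0.
Qed.

Lemma continuous_flat (p : {poly R}) : continuous (flat p).
Proof.
move=> t; have [df _] := is_derive_flat p t.
by apply: differentiable_continuous; apply/derivable1_diffP.
Qed.

Lemma measurable_box_bump a b j (D : set Rd) :
  measurable_fun D (fun y : Rd => box_bump a b j (tnth y)).
Proof.
apply: measurable_funTS; apply: measurable_prod => i _.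
have mflat (g : R -> R) : continuous g ->
    measurable_fun setT (fun y : Rd => flat 1 (g (tnth y i))).
  move=> cg; apply: (@measurableT_comp _ _ _ _ _ _ (fun t : R => flat 1 (g t))).
    apply: continuous_measurable_fun => t; apply: continuous_comp; first exact: cg.
    exact: continuous_flat.
  exact: measurable_tnth.
apply: measurable_funM.
  apply: (mflat (fun t => j.+1%:R * (t - tnth a i))) => t.
  by apply: cvgM; [exact: cvg_cst|apply: cvgB; [exact: cvg_id|exact: cvg_cst]].
apply: (mflat (fun t => j.+1%:R * (tnth b i - t))) => t.
by apply: cvgM; [exact: cvg_cst|apply: cvgB; [exact: cvg_cst|exact: cvg_id]].
Qed.

(** Dominated convergence along the bumps of the box. *)
Lemma integral_box_eq0 (D : set Rd) (f : Rd -> R) a b :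
    measurable D -> measurable_fun D f ->
    (lebesgue_nd d).-integrable D (fun y => (f y ^+ 2)%:E) ->
    box a b `<=` D ->
    (forall j, \int[lebesgue_nd d]_(y in D) (f y * box_bump a b j (tnth y)) = 0) ->
  (\int[lebesgue_nd d]_(y in box a b) (f y)%:E = 0)%E.
Proof.
move=> mD mf f2 abD f0; have mQ := @measurable_box R d a b.
have fi := square_integrable_box mD mf f2 abD.
have mfQ : measurable_fun (box a b) f := measurable_funS mD abD mf.
pose g j (y : Rd) := f y * box_bump a b j (tnth y).
have fg j y : `|g j y| <= `|f y|.
  have /andP[b0 b1] := box_bump_ge0_le1 a b j (tnth y).
  by rewrite normrM (ger0_norm b0) ler_piMr.
have mg j : measurable_fun (box a b) (EFin \o g j).
  by apply/measurable_EFinP; apply: measurable_funM => //; exact: measurable_box_bump.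
have gi j : (lebesgue_nd d).-integrable (box a b) (EFin \o g j).
  by apply: le_integrable fi => // y _; rewrite lee_fin.
have g0 j : (\int[lebesgue_nd d]_(y in box a b) (g j y)%:E = 0)%E.
  have fin : (\int[lebesgue_nd d]_(y in box a b) (g j y)%:E)%E \is a fin_num.
    by apply: (integrable_fin_num _ (gi j)).
  rewrite -(fineK fin); congr (_ %:E); rewrite -[RHS](f0 j) /Rintegral.
  congr fine; rewrite [LHS]integral_mkcond [RHS]integral_mkcond; apply: eq_integral => y _.
  rewrite !patchE; case: ifPn => [/set_mem/abD/mem_set -> //|/negP yab].
  case: ifP => // _; have : ~ (box a b y) by move=> /mem_set.
  move=> /existsNP[i /negP]; rewrite negb_and -!leNgt => yi.
  by rewrite (box_bump_eq0 _ yi) mulr0.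
have f_f : {ae lebesgue_nd d, forall y, box a b y ->
    (fun j => (EFin \o g j) y) @ \oo --> (EFin \o f) y}.
  apply: aeW => y Qy; apply: cvg_EFin; first exact: nearW.
  rewrite -[X in _ --> X]mulr1; apply: cvgM; first exact: cvg_cst.
  exact: cvg_box_bump.
have f_g : {ae lebesgue_nd d, forall y j, box a b y ->
    (`|(EFin \o g j) y| <= (abse \o (EFin \o f)) y)%E}.
  by apply: aeW => y j Qy; rewrite lee_fin.
have [_ _] := dominated_convergence mQ mg (measurable_int _ fi) f_f
  (integrable_abse fi) f_g.
rewrite (_ : [sequence _]_n = cst 0%E); last by apply/funext => j; rewrite /= g0.
by move=> H; apply/esym/(cvg_unique _ _ H) => //; exact: cvg_cst.
Qed.

End box_bump.

(** * Orthonormal lists and their dual forms *)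

Section dotv.
Context {R : realType} {n : nat}.
Notation E := 'rV[R]_n.
Implicit Types (u v w x : E) (e : seq E).

Lemma dotv_linear w : scalar_linear (dotv^~ w).
Proof.
move=> a x y; rewrite /dotv mulr_sumr -big_split; apply: eq_bigr => i _ /=.
by rewrite !mxE mulrDl mulrA.
Qed.

Definition orthonormal_seq e := forall i j, (i < size e)%N -> (j < size e)%N ->
  dotv e`_i e`_j = (i == j)%:R.

Lemma dotv_orthonormal_sum e (c : 'I_(size e) -> R) (j : 'I_(size e)) :
  orthonormal_seq e -> dotv (\sum_(i < size e) c i *: e`_i) e`_j = c j.
Proof.
move=> oe; rewrite (scalar_linear_sum (dotv_linear _)).
rewrite (bigD1 j)//= (scalar_linearZ (dotv_linear _)) oe// eqxx mulr1.
rewrite big1 ?addr0// => i ij.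
by rewrite (scalar_linearZ (dotv_linear _)) oe// (inj_eq val_inj) (negPf ij) mulr0.
Qed.

Lemma orthonormal_span e v : orthonormal_seq e -> v \in <<e>>%VS ->
  v = \sum_(i < size e) dotv v e`_i *: e`_i.
Proof.
move=> oe ve; have vE : v \in <<in_tuple e>>%VS by [].
rewrite {1}(coord_span vE); apply: eq_bigr => i _; congr (_ *: _).
rewrite [in dotv v _](coord_span vE).
by rewrite (dotv_orthonormal_sum (fun j => coord (in_tuple e) j v) i oe).
Qed.

Lemma orthonormal_uniq e : orthonormal_seq e -> uniq e.
Proof.
move=> oe; apply/(uniqP 0) => i j ie je eij.
have := oe i j ie je; rewrite eij oe// eqxx; case: eqP => // _ /eqP.
by rewrite oner_eq0.
Qed.

Lemma dotv_orthonormal e v w : orthonormal_seq e -> v \in e -> w \in e ->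
  dotv v w = (v == w)%:R.
Proof.
move=> oe /(nthP 0)[i ie <-] /(nthP 0)[j je <-].
by rewrite oe// nth_uniq// orthonormal_uniq.
Qed.

(** For an orthonormal list e this is the wedge product of the forms dual to
    the vectors of e: among the increasing sublists of an orthonormal basis
    that contains e, it is nonzero on e alone. *)
Definition dual_form e (vs : seq E) : R :=
  if size vs == size e then
    \det (\matrix_(i < size e, j < size e) dotv vs`_i e`_j)
  else 0.

(** Multilinearity and alternation are those of the determinant in its rows. *)
Lemma altform_dual_form e : altform fullv (size e)%:Z (dual_form e).
Proof.
apply/altformP; split=> [vs|a v v' vs1 vs2|vs].
- by rewrite /dual_form; case: eqP => [->|].
- rewrite /dual_form !size_cat/=.
  case: eqP => [sz|_]; last by rewrite mulr0 addr0.
  have i1 : (size vs1 < size e)%N by rewrite -sz addnS ltnS leq_addr.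
  pose i0 := Ordinal i1.
  rewrite (@determinant_multilinear _ _ _
    (\matrix_(i < size e, j < size e) dotv (vs1 ++ v :: vs2)`_i e`_j)
    (\matrix_(i < size e, j < size e) dotv (vs1 ++ v' :: vs2)`_i e`_j) i0 a 1).
  + by rewrite mul1r.
  + apply/rowP => j; rewrite !mxE /= !nth_cat ltnn subnn/= mul1r.
    by rewrite dotv_linear.
  + apply/matrixP => i j; rewrite !mxE !nth_cat; case: ltnP => // le1.
    case: (_ - _)%N (subnKC le1) => //=; rewrite addn0 => /esym/eqP.
    by rewrite (inj_eq val_inj (lift i0 i) i0) eq_sym (negPf (neq_lift _ _)).
  + apply/matrixP => i j; rewrite !mxE !nth_cat; case: ltnP => // le1.
    case: (_ - _)%N (subnKC le1) => //=; rewrite addn0 => /esym/eqP.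
    by rewrite (inj_eq val_inj (lift i0 i) i0) eq_sym (negPf (neq_lift _ _)).
- move=> nu; rewrite /dual_form; case: eqP => // sz.
  have /(uniqPn 0)[i [j [ij jsz vij]]] := nu.
  have je : (j < size e)%N by rewrite -sz.
  have ie : (i < size e)%N := ltn_trans ij je.
  apply: (@determinant_alternate _ _ _ (Ordinal ie) (Ordinal je)).
    by rewrite -(inj_eq val_inj)/= ltn_eqF.
  by move=> k; rewrite !mxE /= vij.
Qed.

Lemma dual_form_id e : orthonormal_seq e -> dual_form e e = 1.
Proof.
move=> oe; rewrite /dual_form eqxx (_ : \matrix_(_, _) _ = 1%:M) ?det1//.
by apply/matrixP => i j; rewrite !mxE oe.
Qed.

Lemma dual_form_orthogonal e vs v : v \in vs -> (forall w, w \in e -> dotv v w = 0) ->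
  dual_form e vs = 0.
Proof.
move=> /(nthP 0)[i iv <-] ve; rewrite /dual_form; case: eqP => // sz.
have ie : (i < size e)%N by rewrite -sz.
rewrite (expand_det_row _ (Ordinal ie)) big1// => j _.
by rewrite !mxE /= ve ?mul0r// mem_nth.
Qed.

Lemma orthonormal_mask e (s : bitseq) : orthonormal_seq e -> orthonormal_seq (mask s e).
Proof.
move=> oe i j ie je; have ue := mask_uniq (orthonormal_uniq oe) s.
by rewrite (dotv_orthonormal oe) ?nth_uniq//; apply: mem_mask (mem_nth _ _).
Qed.

Lemma mem_mask_nth e (s : bitseq) i : uniq e -> (i < size e)%N ->
  (e`_i \in mask s e) = nth false s i.
Proof. by move=> ue ie; rewrite in_mask// mem_nth// index_uniq. Qed.

(** Two distinct sublists of the same length differ by some vector, which is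
    orthogonal to all of the other list and gives the determinant a zero row. *)
Lemma dual_form_mask e (s s' : (size e).-tuple bool) : orthonormal_seq e ->
  dual_form (mask (map negb s) e) (mask (map negb s') e) = (s' == s)%:R.
Proof.
move=> oe; have ue := orthonormal_uniq oe.
have [->|s's] := eqVneq s' s; first by rewrite dual_form_id//; exact: orthonormal_mask.
have [sz|sz] := eqVneq (size (mask (map negb s') e)) (size (mask (map negb s) e));
  last by rewrite /dual_form (negPf sz).
(* The complements of s and s' have the same number of elements, so s cannot
   be properly contained in s'. *)
have [i si s'i] : exists2 i : 'I_(size e), tnth s i & ~~ tnth s' i.
  apply/exists_inP; apply: contraT => /exists_inPn H.
  suff : s == s' by rewrite eq_sym (negPf s's).
  have cardE (t : (size e).-tuple bool) : count id t = #|[set i | tnth t i]%SET|.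
    by rewrite -sum1_count big_tuple sum1dep_card.
  have : [set i | tnth s i]%SET == [set i | tnth s' i]%SET.
    rewrite eqEcard -!cardE; apply/andP; split.
      apply/fintype.subsetP => i; rewrite !inE => si.
      by have := H i si; rewrite negbK.
    move: sz; rewrite !size_mask ?size_map ?size_tuple// !count_map => sz.
    have := etrans (count_predC id s) (size_tuple s).
    rewrite -[X in _ = X -> _](etrans (count_predC id s') (size_tuple s')).
    rewrite (_ : count (predC id) s' = count (predC id) s)//.
    by move=> /addIn ->.
  move=> /eqP ss'; apply/eqP/eq_from_tnth => i.
  have : (i \in [set i | tnth s i]%SET) = (i \in [set i | tnth s' i]%SET) by rewrite ss'.
  by rewrite !inE.
rewrite (@dual_form_orthogonal _ _ e`_i)//.
  rewrite mem_mask_nth// (nth_map false) ?size_tuple//.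
  by rewrite -tnth_nth.
move=> w we; rewrite (dotv_orthonormal oe) ?mem_nth//; last exact: mem_mask we.
case: eqP => // iw; move: we; rewrite -iw mem_mask_nth// (nth_map false) ?size_tuple//.
by rewrite -tnth_nth si.
Qed.

End dotv.

(** * Coordinates on a cell *)

Section cell.
Context {R : realType} {n : nat} (o : set 'rV[R]_n -> seq 'rV[R]_n) (T : set 'rV[R]_n).
Notation E := 'rV[R]_n.
Hypothesis (oT : orthonormal_seq (o T)).
Implicit Types (u v w x : E).
Notation chartT := (@chart R n o T).
Notation chartdom := (@chart_dom R n o T).
Notation Rd := ((dim o T).-tuple (measurableTypeR R)).

(** A left inverse of the chart, defined on the whole ambient space so that
    functions of the coordinates are smooth test functions. *)
Definition coordinate (i : 'I_(dim o T)) x : R := dotv (x - xget 0 T) (o T)`_i.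

Lemma coordinate_chart i (y : Rd) : coordinate i (chartT y) = tnth y i.
Proof.
rewrite /coordinate /chart addrAC subrr add0r.
exact: (dotv_orthonormal_sum (fun i => tnth y i : R)).
Qed.

Lemma chart_sub (y z : Rd) : chartT z - chartT y =
  \sum_(i < dim o T) ((tnth z i : R) - tnth y i) *: (o T)`_i.
Proof.
rewrite /chart opprD addrACA subrr add0r -sumrB.
by apply: eq_bigr => i _; rewrite -scalerBl.
Qed.

Lemma sum_frame_tangent (c : 'I_(dim o T) -> R) :
  \sum_(i < dim o T) c i *: (o T)`_i \in tangent o T.
Proof.
by apply: memv_suml => i _; rewrite memvZ// memv_span// mem_nth.
Qed.

(** Close coordinates give close points, and the difference of two points of
    the chart is tangent, so that half of the radius at one point works at the
    neighbouring ones. *)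
Lemma sup_open_chart_dom : sup_open (chartdom).
Proof.
move=> y [Ty [e e0 He]].
(* Lipschitz constant of the chart from the maximum norm, made positive. *)
pose M := 1 + \sum_(i < dim o T) `|(o T)`_i|.
have M0 : 0 < M by rewrite ltr_pwDl// sumr_ge0.
exists (e / 2 / M) => [|z zy]; first by rewrite !divr_gt0.
have zyT : chartT z - chartT y \in tangent o T.
  by rewrite chart_sub sum_frame_tangent.
have nzy : `|chartT z - chartT y| < e / 2.
  rewrite chart_sub; apply: (le_lt_trans (ler_norm_sum _ _ _)).
  apply: (@le_lt_trans _ _ (e / 2 / M * \sum_(i < dim o T) `|(o T)`_i|)).
    by rewrite mulr_sumr; apply: ler_sum => i _; rewrite normrZ ler_wpM2r// ltW.
  rewrite -[X in _ < X](divfK (lt0r_neq0 M0)) ltr_pM2l ?divr_gt0//.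
  by rewrite /M ltrDr.
rewrite /chart_dom /=; split.
  rewrite -(subrK (chartT y) (chartT z)) addrC; apply: He => //.
  by apply: lt_trans nzy _; rewrite ltr_pdivrMr// ltr_pMr// ltr1n.
exists (e / 2); first by rewrite divr_gt0.
move=> v vT nv.
rewrite -(subrK (chartT y) (chartT z)) addrAC addrC; apply: He.
  exact: memvD.
by apply: (le_lt_trans (ler_normD _ _)); rewrite [e]splitr ltrD.
Qed.

Lemma measurable_chart_dom : measurable (chartdom).
Proof. by apply: measurable_sup_open; exact: sup_open_chart_dom. Qed.

Lemma coordinateE i x : coordinate i x = dotv x (o T)`_i - dotv (xget 0 T) (o T)`_i.
Proof.
rewrite /coordinate addrC -scaleN1r dotv_linear mulN1r addrC //.
Qed.

Lemma chart_coordinate x : T x -> orthonormal_frame T (o T) ->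
  x = chartT [tuple coordinate i x | i < dim o T].
Proof.
move=> Tx [_ sT _]; have T0 : T (xget 0 T) by apply: (xgetPex 0); exists x.
rewrite /chart -[LHS](addrNK (xget 0 T)) addrC; congr (_ + _).
rewrite {1}(orthonormal_span oT (sT _ _ Tx T0)).
by apply: eq_bigr => i _; rewrite tnth_mktuple.
Qed.

Definition bump_on (a b : (dim o T).-tuple R) (j : nat) x : R :=
  box_bump a b j (fun i => coordinate i x).

Lemma bump_on_chart a b j (y : Rd) : bump_on a b j (chartT y) = box_bump a b j (tnth y).
Proof.
rewrite /bump_on; congr (box_bump _ _ _ _); apply/funext => i.
exact: coordinate_chart.
Qed.

Lemma smooth_bump_on a b j : smooth (bump_on a b j).
Proof.
pose F (i : 'I_(dim o T)) (x : E) : R :=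
  flat 1 (j.+1%:R * (coordinate i x - tnth a i)) *
  flat 1 (j.+1%:R * (tnth b i - coordinate i x)).
have -> : bump_on a b j = \prod_(i < dim o T) F i.
  by rewrite fct_prodE.
apply: smooth_prod => i _.
have sflat (s c : R) : smooth (fun x => flat 1 (s * dotv x (o T)`_i + c)).
  exact: smooth_flat (dotv_linear _).
apply: (@smoothM _ _
  (fun x => flat 1 (j.+1%:R * (coordinate i x - tnth a i)))
  (fun x => flat 1 (j.+1%:R * (tnth b i - coordinate i x)))).
- have -> : (fun x => flat 1 (j.+1%:R * (coordinate i x - tnth a i))) =
    (fun x => flat 1 (j.+1%:R * dotv x (o T)`_i
              + - j.+1%:R * (dotv (xget 0 T) (o T)`_i + tnth a i))).
    by apply/funext => x; rewrite coordinateE; congr flat; ring.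
  exact: sflat.
- have -> : (fun x => flat 1 (j.+1%:R * (tnth b i - coordinate i x))) =
    (fun x => flat 1 (- j.+1%:R * dotv x (o T)`_i
              + j.+1%:R * (dotv (xget 0 T) (o T)`_i + tnth b i))).
    by apply/funext => x; rewrite coordinateE; congr flat; ring.
  exact: sflat.
Qed.

Lemma continuous_coordinate i : continuous (coordinate i).
Proof.
move=> x; have -> : coordinate i =
    (fun x => 1 * dotv x (o T)`_i + cst (- dotv (xget 0 T) (o T)`_i) x).
  by apply/funext => z; rewrite coordinateE mul1r.
apply/differentiable_continuous/smooth_differentiable/smooth_affine.
  exact: smooth_scalar_linear (dotv_linear _).
exact: smooth_cst.
Qed.

(** A point of T whose coordinates lie in the closed box is in the relative
    interior; so the points with some coordinate outside of the closed box
    form a neighbourhood of the relative boundary. *)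
Lemma bump_on_vanishes a b j : orthonormal_frame T (o T) ->
    closed_box a b `<=` chartdom ->
  exists U : set E, [/\ open U, relbd o T `<=` U & forall x, U x -> bump_on a b j x = 0].
Proof.
move=> fT abD.
exists (\bigcup_(i in [set: 'I_(dim o T)])
  (coordinate i @^-1` [set t | t < tnth a i] `|` coordinate i @^-1` [set t | tnth b i < t])).
split.
- apply: bigcup_open => i _; apply: openU.
    apply: open_comp; [by move=> x _; exact: continuous_coordinate|exact: open_lt].
  apply: open_comp; [by move=> x _; exact: continuous_coordinate|exact: open_gt].
- move=> x [Tx nTx]; apply: contrapT => nU; apply: nTx.
  rewrite (chart_coordinate Tx fT); apply: abD => i; rewrite tnth_mktuple.
  apply/andP; split; rewrite leNgt; apply/negP => xi; apply: nU; exists i => //.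
    by left.
  by right.
- move=> x [i _ xi]; apply: (@box_bump_eq0 _ _ _ _ _ _ i).
  by apply/orP; case: xi => /= /ltW; [left|right].
Qed.

End cell.

(** * A form that vanishes weakly vanishes almost everywhere *)

Section uniqueness.
Context {R : realType} {n : nat} (o : set 'rV[R]_n -> seq 'rV[R]_n) (T : set 'rV[R]_n).
Notation E := 'rV[R]_n.
Hypothesis (fT : orthonormal_frame T (o T)).
Notation chartT := (@chart R n o T).
Notation chartdom := (@chart_dom R n o T).
Notation Rd := ((dim o T).-tuple (measurableTypeR R)).
Notation lambda := (lebesgue_nd (dim o T)).

Let oT : orthonormal_seq (o T). Proof. by case: fT. Qed.

(** The masks of the orthonormal basis give the coefficients of f, so that
    this says that f, as a form on T, vanishes almost everywhere. *)
Definition ae_zero (f : @dform R n) := forall s : (dim o T).-tuple bool,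
  lambda.-negligible [set y : Rd | chartdom y /\ f (chartT y) (mask s (o T)) != 0].

Lemma altform_size (V : {vspace E}) k w vs : altform V k w -> {subset vs <= V} ->
  (size vs)%:Z != k -> w vs = 0.
Proof.
by move=> [H _ _] vsV; apply: contraNeq => /eqP wvs; apply/eqP/H.
Qed.

Lemma mask_tangent (s : bitseq) : {subset mask s (o T) <= tangent o T}.
Proof. by move=> v /mem_mask; exact: memv_span. Qed.

Lemma chart_dom_in (y : Rd) : chartdom y -> T (chartT y).
Proof. by case. Qed.

(** The fundamental lemma of the calculus of variations for forms. To reach
    the coefficient of f on the basis vectors selected by s, test against the
    dual form of the complementary vectors multiplied by a bump supported in a
    box; up to a sign the wedge product is the coefficient times the bump.
    Letting the bumps tend to the indicator, the coefficient has integral zero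
    over all boxes, hence vanishes almost everywhere. *)
Theorem weak_zero k f : L2 o T k f ->
    (forall phi, smooth_form ((dim o T)%:Z - k) phi -> vanishes_near (relbd o T) phi ->
       integral_form o T (wedge f phi) = 0) ->
  ae_zero f.
Proof.
move=> [formf L2f] f0 s.
have [ks|ks] := eqVneq (size (mask s (o T)))%:Z k; last first.
  apply: negligibleS (negligible_set0 _) => y [/chart_dom_in/formf ky].
  by rewrite (altform_size ky _ ks) ?eqxx//; exact: mask_tangent.
have [mf f2] := L2f s.
apply: negligible_sup_open; first exact: sup_open_chart_dom.
move=> a b abD; have mD : measurable chartdom by apply: measurable_chart_dom.
have abD' : box a b `<=` chartdom.
  by move=> y yab; apply: abD => i; have /andP[? ?] := yab i; rewrite !ltW.
pose fs (y : Rd) := f (chartT y) (mask s (o T)).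
have fsi : lambda.-integrable (box a b) (EFin \o fs).
  exact: square_integrable_box mf f2 abD'.
apply: ae0_of_boxes => // a' b' ab'.
apply: (integral_box_eq0 mD mf f2) => [|j].
  by move=> y yab; apply: abD; apply: ab' => i; have /andP[? ?] := yab i; rewrite !ltW.
pose N (s' : (size (o T)).-tuple bool) : nat :=
  (\sum_(i < size (o T)) \sum_(j < size (o T) | (i < j)%N)
    (~~ tnth s' i && tnth s' j))%N.
pose al := dual_form (mask (map negb s) (o T)).
(* The factor (-1) ^+ N s compensates the sign of the shuffle s. *)
pose phi : dform := fun x vs => (-1) ^+ N s * al vs * @bump_on _ _ o T a' b' j x.
have abD1 : closed_box a' b' `<=` chartdom.
  exact: subset_trans abD.
rewrite -(f0 phi).
- rewrite /integral_form /integral_fun; apply: eq_Rintegral => y _.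
  rewrite /wedge (bigD1 s)//= [X in _ + X]big1 ?addr0 => [|s' s's]; last first.
    rewrite /phi /al.
    by rewrite (dual_form_mask s s' oT) (negPf s's) mulr0 mul0r mulr0.
  rewrite -/(N s) /phi /al (dual_form_mask s s oT) eqxx mulr1 bump_on_chart// -/(fs y).
  by rewrite mulrACA -expr2 sqrr_sign mul1r.
- have szmask (m : bitseq) : size m = dim o T -> size (mask m (o T)) = count id m.
    exact: size_mask.
  have kE : (dim o T)%:Z - k = (size (mask (map negb s) (o T)))%:Z.
    rewrite -ks !szmask ?size_map ?size_tuple// count_map.
    rewrite -[X in X%:Z - _](etrans (count_predC id s) (size_tuple s)) PoszD.
    by rewrite addrC addKr.
  have altal : altform fullv ((dim o T)%:Z - k) al by rewrite kE; exact: altform_dual_form.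
  split=> [x|vs].
    apply/altformP; have /altformP[H1 H2 H3] := altal; rewrite /phi; split.
    + by move=> vs phivs; apply: H1 => al0; apply: phivs; rewrite al0 mulr0 mul0r.
    + by move=> c v v' vs1 vs2; rewrite H2; ring.
    + by move=> vs /H3 ->; rewrite mulr0 mul0r.
  rewrite /phi; have -> : (fun x => (-1) ^+ N s * al vs * @bump_on _ _ o T a' b' j x) =
    (fun x => ((-1) ^+ N s * al vs) * @bump_on _ _ o T a' b' j x + cst 0 x).
    by apply/funext => x; rewrite addr0.
  by apply: smooth_affine; [exact: smooth_bump_on|exact: smooth_cst].
- have [U [oU RU U0]] := bump_on_vanishes oT j fT abD1.
  by exists U; split => // x vs Ux; rewrite /phi U0// mulr0.
Qed.

End uniqueness.

(** * The weak exterior derivative *)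

Section zero_forms.
Context {R : realType} {n : nat} (o : set 'rV[R]_n -> seq 'rV[R]_n) (T : set 'rV[R]_n).
Notation E := 'rV[R]_n.
Notation dform := (@dform R n).
Implicit Types (f g u v phi : dform).
Notation chartT := (@chart R n o T).
Notation chartdom := (@chart_dom R n o T).
Notation Rd := ((dim o T).-tuple (measurableTypeR R)).
Notation lambda := (lebesgue_nd (dim o T)).

Lemma integral_fun_eq (h1 h2 : E -> R) : (forall x, T x -> h1 x = h2 x) ->
  integral_fun o T h1 = integral_fun o T h2.
Proof.
by move=> h12; apply: eq_Rintegral => y /set_mem/chart_dom_in; exact: h12.
Qed.

Lemma integral_fun0 : integral_fun o T (fun=> 0) = 0.
Proof. by rewrite /integral_fun /Rintegral integral0. Qed.

Lemma integral_fun_eq0 (h : E -> R) : (forall x, T x -> h x = 0) ->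
  integral_fun o T h = 0.
Proof. by move=> h0; rewrite -[RHS]integral_fun0; exact: integral_fun_eq. Qed.

Lemma ae_zero_integral f (h : E -> R) : ae_zero o T f ->
    (forall x, (forall s : (dim o T).-tuple bool, f x (mask s (o T)) = 0) -> h x = 0) ->
  integral_fun o T h = 0.
Proof.
move=> f0 hf; apply: Rintegral_null.
apply: (@negligibleS _ _ _ lambda (\big[setU/set0]_(s : (dim o T).-tuple bool)
  [set y : Rd | chartdom y /\ f (chartT y) (mask s (o T)) != 0])); last first.
  by elim/big_ind: _ => //; [exact: negligible_set0|exact: negligibleU].
move=> y /= [Dy hy]; rewrite -bigcup_seq/=.
apply: contrapT => nex; move/eqP: hy; apply; apply: hf => s.
apply: contrapT => fs; apply: nex; exists s; first by rewrite /= mem_index_enum.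
by split => //; apply/eqP.
Qed.

Lemma ae_zero_wedge f phi : ae_zero o T f -> integral_form o T (wedge f phi) = 0.
Proof.
move=> f0; apply: (ae_zero_integral f0) => x fx0; rewrite /wedge big1// => s _.
by rewrite fx0 mulr0 mul0r.
Qed.

Lemma ae_zero_dot f g : ae_zero o T f -> dot_form o T f g = 0.
Proof.
move=> f0; apply: (ae_zero_integral f0) => x fx0; rewrite big1// => s _.
by rewrite fx0 mul0r.
Qed.

Lemma dot_formC f g : dot_form o T f g = dot_form o T g f.
Proof.
by apply: integral_fun_eq => x _; apply: eq_bigr => s _; rewrite mulrC.
Qed.

Definition zero_form : dform := fun _ _ => 0.

Lemma ae_zero_form : ae_zero o T zero_form.
Proof.
move=> s; apply: negligibleS (negligible_set0 _) => y [_].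
by rewrite /zero_form eqxx.
Qed.

Lemma is_form_zero k : is_form o T k zero_form.
Proof. by move=> x _; split=> // *; rewrite /zero_form mulr0 addr0. Qed.

Lemma wedge_zero_r f : integral_form o T (wedge f zero_form) = 0.
Proof.
by apply: integral_fun_eq0 => x _; rewrite /wedge big1// => s _; rewrite mulr0.
Qed.

Lemma L2_zero k : L2 o T k zero_form.
Proof.
split; first exact: is_form_zero.
move=> s; split; first exact: measurable_cst.
rewrite /zero_form expr0n/=; apply/integrableP; split; first exact: measurable_cst.
by rewrite integral0_eq ?ltry// => y _; rewrite abse0.
Qed.

Lemma stokes_zero k f phi : ae_zero o T f -> stokes o T k zero_form f phi = 0.
Proof.
by move=> f0; rewrite /stokes !ae_zero_wedge ?mulr0 ?addr0//; exact: ae_zero_form.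
Qed.

Lemma is_ext_d_zero k : is_ext_d o T k zero_form zero_form.
Proof.
split; first exact: L2_zero.
by move=> phi _ _; apply: stokes_zero; exact: ae_zero_form.
Qed.

Lemma ext_dP k u : spaceX o T k u -> is_ext_d o T k u (ext_d o T k u).
Proof. by move=> [_ exf]; exact: (xgetPex zero_form exf). Qed.

(** If phi is a test form, so is d phi; since d d phi = 0, the Stokes identity
    of u with d phi says that the integral of du wedge d phi vanishes, which
    is the identity of du with phi and derivative zero. *)
Theorem is_ext_d_ext_d k u : spaceX o T k u ->
  is_ext_d o T (k + 1) (ext_d o T k u) zero_form.
Proof.
move=> Xu; have [L2f fu] := ext_dP Xu.
split; first exact: L2_zero.
move=> phi; rewrite opprD addrA => sphi vphi.
have sdphi : smooth_form ((dim o T)%:Z - k - 1) (dsmooth phi).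
  rewrite -[X in smooth_form X _](subrK 1 _); exact: smooth_form_dsmooth.
have := fu _ sdphi (vanishes_near_dsmooth vphi).
rewrite /stokes (ae_zero_wedge _ ae_zero_form) add0r.
have -> : dsmooth (dsmooth phi) = zero_form.
  apply/funext => x; apply/funext => vs; apply: dsmooth_dsmooth; exact: sphi.2.
by rewrite wedge_zero_r mulr0 addr0 => ->; rewrite mulr0.
Qed.

Lemma spaceX_ext_d k u : spaceX o T k u -> spaceX o T (k + 1) (ext_d o T k u).
Proof.
move=> Xu; split; first by have [] := ext_dP Xu.
by exists zero_form; exact: is_ext_d_ext_d.
Qed.

Hypothesis fT : orthonormal_frame T (o T).

(** The form ext_d is an arbitrary choice among the weak derivatives; when
    zero is one of them, both have the same Stokes pairing with test forms,
    and the choice is null by uniqueness. *)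
Theorem ext_d_ae_zero k u :
  is_ext_d o T k u zero_form -> ae_zero o T (ext_d o T k u).
Proof.
move=> u0; have [L2f fu] : is_ext_d o T k u (ext_d o T k u).
  by apply: (xgetPex zero_form); exists zero_form.
apply: (weak_zero fT L2f) => phi; rewrite opprD addrA => sphi vphi.
have := fu phi sphi vphi; have [_ /(_ phi sphi vphi)] := u0.
by rewrite /stokes (ae_zero_wedge _ ae_zero_form) add0r => ->; rewrite addr0.
Qed.

Lemma ext_d_zero_form k : ae_zero o T (ext_d o T k zero_form).
Proof. exact/ext_d_ae_zero/is_ext_d_zero. Qed.

Lemma ext_d_ext_d_ae_zero k u : spaceX o T k u ->
  ae_zero o T (ext_d o T (k + 1) (ext_d o T k u)).
Proof. by move=> /is_ext_d_ext_d; exact: ext_d_ae_zero. Qed.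

Lemma spaceX0_zero k : spaceX0 o T k zero_form.
Proof.
split; first by split; [exact: L2_zero|exists zero_form; exact: is_ext_d_zero].
by move=> phi _; apply: stokes_zero; exact: ext_d_zero_form.
Qed.

Lemma spaceY_zero k : spaceY o T k zero_form.
Proof.
split; last by move=> z _; apply: ae_zero_dot; exact: ae_zero_form.
split; first exact: spaceX0_zero.
by move=> w _; apply: ae_zero_wedge; exact: ae_zero_form.
Qed.

Lemma spaceP_zero s k : spaceP o T s k zero_form.
Proof.
split; first exact: is_form_zero.
move=> vs _; exists (fun=> 0) => //.
elim: s => [|s IH] /=; first by exists 0.
exists 0, (fun _ _ => 0); split => // x.
by rewrite big1 ?addr0// => i _; rewrite mulr0.
Qed.

Lemma kappa_zero : kappa o T zero_form = zero_form.
Proof. by []. Qed.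

End zero_forms.

(** * Moments of a cell and its barycentre *)

Section barycentre.
Context {R : realType} {n : nat} (o : set 'rV[R]_n -> seq 'rV[R]_n) (T : set 'rV[R]_n).
Notation E := 'rV[R]_n.
Notation dform := (@dform R n).
Notation chartT := (@chart R n o T).
Notation chartdom := (@chart_dom R n o T).
Notation d := (dim o T).
Notation Rd := (d.-tuple (measurableTypeR R)).
Notation lambda := (lebesgue_nd d).
Hypothesis fT : orthonormal_frame T (o T).
Hypothesis bT : forall w, exists M : R, forall x, T x -> `|dotv x w| <= M.

Let oT : orthonormal_seq (o T). Proof. by case: fT. Qed.
Let mD : measurable chartdom. Proof. by apply: measurable_chart_dom. Qed.

Lemma chart_dom_bounded :
  exists M : R, forall (y : Rd) i, chartdom y -> `|tnth y i : R| <= M.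
Proof.
pose M i := sval (cid (bT (o T)`_i)) + `|dotv (xget 0 T) (o T)`_i|.
have HM (i : 'I_d) (y : Rd) : chartdom y -> `|tnth y i : R| <= M i.
  move=> Dy; rewrite -(coordinate_chart oT) coordinateE.
  apply: (le_trans (ler_normB _ _)); rewrite lerD2r.
  by apply: (svalP (cid (bT (o T)`_i))); exact: chart_dom_in Dy.
exists (\sum_(i < d) `|M i|) => y i Dy; apply: (le_trans (HM i y Dy)).
by apply: (le_trans (ler_norm _)); rewrite (bigD1 i)//= lerDl sumr_ge0.
Qed.

Lemma chart_dom_lty : (lambda chartdom < +oo)%E.
Proof.
have [M HM] := chart_dom_bounded.
pose K : R := `|M| + 1.
apply: le_lt_trans (lebesgue_nd_box [tuple - K | i < d] [tuple K | i < d]).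
apply: le_measure; rewrite ?inE//; first exact: measurable_box.
move=> y Dy i; rewrite !tnth_mktuple -ltr_norml.
by apply: (le_lt_trans (HM y i Dy)); rewrite (le_lt_trans (ler_norm _))// ltrDl.
Qed.

Lemma integrable_bounded (h : Rd -> R) : measurable_fun chartdom h ->
  (exists M, forall y, chartdom y -> `|h y| <= M) -> lambda.-integrable chartdom (EFin \o h).
Proof.
move=> mh [M HM]; apply: measurable_bounded_integrable => //; first exact: chart_dom_lty.
exists M; split; first exact: num_real.
by move=> K MK y Dy /=; apply: (le_trans (HM y Dy)); exact: ltW.
Qed.

Lemma integrable_coordinate (i : 'I_d) :
  lambda.-integrable chartdom (EFin \o (fun y : Rd => tnth y i : R)).
Proof.
apply: integrable_bounded; first by apply: measurable_funTS; exact: measurable_tnth.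
by have [M HM] := chart_dom_bounded; exists M => y Dy; exact: HM.
Qed.

Lemma integrable_cst_dom (c : R) : lambda.-integrable chartdom (EFin \o cst c).
Proof. by apply: integrable_bounded => //; exists `|c|. Qed.

Definition volume : R := integral_fun o T (fun=> 1).

Definition moment (i : 'I_d) : R := \int[lambda]_(y in chartdom) (tnth y i : R).

Lemma Rintegral_affine (c : R) (r : 'I_d -> R) :
  \int[lambda]_(y in chartdom) (c + \sum_(i < d) r i * (tnth y i : R)) =
  c * volume + \sum_(i < d) r i * moment i.
Proof.
have key (s : seq 'I_d) :
    lambda.-integrable chartdom
      (EFin \o (fun y : Rd => c + \sum_(i <- s) r i * (tnth y i : R))) /\
    \int[lambda]_(y in chartdom) (c + \sum_(i <- s) r i * (tnth y i : R)) =
    c * volume + \sum_(i <- s) r i * moment i.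
  elim: s => [|i s [IHi IH]].
    split.
      apply: eq_integrable (integrable_cst_dom c) => // y _.
      by rewrite /= big_nil addr0.
    rewrite big_nil addr0 /volume /integral_fun -RintegralZl//; last exact: integrable_cst_dom.
    by apply: eq_Rintegral => y _; rewrite big_nil addr0 mulr1.
  have ri : lambda.-integrable chartdom (EFin \o (fun y : Rd => r i * (tnth y i : R))).
    apply: eq_integrable (integrableZl mD (r i) (integrable_coordinate i)) => // y _.
  have E1 (y : Rd) : c + \sum_(j <- i :: s) r j * (tnth y j : R) =
      r i * (tnth y i : R) + (c + \sum_(j <- s) r j * (tnth y j : R)).
    by rewrite big_cons addrCA.
  split.
    apply: eq_integrable (integrableD mD ri IHi) => // y _.
    by rewrite [RHS]/= E1.
  rewrite big_cons addrCA -IH -RintegralZl//; last exact: integrable_coordinate.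
  by rewrite -RintegralD//; apply: eq_Rintegral => y _; rewrite E1.
exact: (key _).2.
Qed.

(** On a cell of volume zero the quotient that defines the barycentre is
    meaningless, but then all integrals vanish. *)
Lemma volume0_integral (h : E -> R) : volume = 0 -> integral_fun o T h = 0.
Proof.
rewrite /volume /integral_fun Rintegral_cst// mul1r => /eqP V0.
have l0 : lambda chartdom = 0%E.
  apply/eqP; rewrite -(fineK (x := lambda chartdom)) ?eqe//.
  by rewrite ge0_fin_numE//; exact: chart_dom_lty.
apply: Rintegral_null; exists chartdom; split => //.
by move=> y [].
Qed.

Hypothesis V0 : volume != 0.

Definition mean : Rd := [tuple moment i / volume | i < d].

(** The chart is affine, so the mean of the points is the point whose
    coordinates are the means of the coordinates; in particular it lies in the
    affine span of the cell. *)
Lemma barycentre_chart : barycentre o T = chartT mean.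
Proof.
apply/rowP => k; rewrite mxE -/volume.
have -> : integral_fun o T (fun x => x 0 k) =
    xget 0 T 0 k * volume + \sum_(i < d) (o T)`_i 0 k * moment i.
  rewrite -Rintegral_affine; apply: eq_Rintegral => y _.
  rewrite /chart mxE summxE; congr (_ + _); apply: eq_bigr => i _.
  by rewrite mxE mulrC.
rewrite mulrDl mulfK// /chart mxE summxE mulr_suml; congr (_ + _).
by apply: eq_bigr => i _; rewrite mxE tnth_mktuple [RHS]mulrAC [moment i * _]mulrC.
Qed.

Lemma sub_barycentre_tangent x : T x -> x - barycentre o T \in tangent o T.
Proof.
move=> Tx; rewrite {1}(chart_coordinate oT Tx fT) barycentre_chart chart_sub.
exact: sum_frame_tangent.
Qed.

(** Functions that are linear in x - b_T have mean zero; this is what puts the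
    contraction of a constant 1-form in W^0. *)
Lemma integral_centred (l : E -> R) : scalar_linear l ->
  integral_fun o T (fun x => l (x - barycentre o T)) = 0.
Proof.
move=> ll; rewrite /integral_fun barycentre_chart.
transitivity (\int[lambda]_(y in chartdom)
  (- \sum_(i < d) l (o T)`_i * tnth mean i + \sum_(i < d) l (o T)`_i * (tnth y i : R))).
  apply: eq_Rintegral => y _; rewrite chart_sub (scalar_linear_sum ll).
  rewrite addrC -sumrB; apply: eq_bigr => i _.
  by rewrite (scalar_linearZ ll) mulrC mulrBr.
rewrite Rintegral_affine mulNr mulr_suml addrC -sumrB big1// => i _.
by rewrite tnth_mktuple -mulrA divfK// subrr.
Qed.

End barycentre.

(** * Constant forms and their Koszul contractions *)

Section constant_forms.
Context {R : realType} {n : nat} (o : set 'rV[R]_n -> seq 'rV[R]_n) (T : set 'rV[R]_n).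
Notation E := 'rV[R]_n.
Notation dform := (@dform R n).
Implicit Types (c w : seq E -> R) (m : int).

Lemma altform_restrict (V : {vspace E}) m c : altform fullv m c -> altform V m c.
Proof. by move=> /altformP[H1 H2 H3]; split=> *; [exact: H1|exact: H2|exact: H3]. Qed.

Lemma altform_multilinear m c : altform fullv m c -> multilinear c.
Proof. by move=> /altformP[]. Qed.

Lemma altform_adjacent m c : altform fullv m c -> adjacent_alternating c.
Proof. by move=> /altformP[_ _ ?]; exact: uniq_adjacent_alternating. Qed.

Lemma altform_cons m c v : altform fullv (m + 1) c -> altform fullv m (fun vs => c (v :: vs)).
Proof.
move=> /altformP[H1 H2 H3]; apply/altformP; split.
- by move=> vs /H1 /=; rewrite -addn1 PoszD => /addIr.
- by move=> a u u' vs1 vs2; exact: (H2 a u u' (v :: vs1)).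
- by move=> vs nu; apply: H3; rewrite /= negb_and nu orbT.
Qed.

Lemma altform_cons_linear m c vs : altform fullv m c -> scalar_linear (fun v => c (v :: vs)).
Proof. by move=> /altformP[_ H2 _] a x y; exact: (H2 a x y [::]). Qed.

Lemma altform_size_scale m c : altform fullv m c ->
  altform fullv m (fun vs => (size vs)%:R * c vs).
Proof.
move=> /altformP[H1 H2 H3]; apply/altformP; split.
- by move=> vs nz; apply: H1 => c0; apply: nz; rewrite c0 mulr0.
- by move=> a u u' vs1 vs2; rewrite H2 !size_cat /=; ring.
- by move=> vs /H3 ->; rewrite mulr0.
Qed.

Lemma polyfun1_affine (l : E -> R) (c : R) : scalar_linear l ->
  polyfun 1 (fun x => c + l x).
Proof.
move=> ll; exists c, (fun i _ => l (delta_mx 0 i)); split=> [i|x].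
  by exists (l (delta_mx 0 i)).
by rewrite {1}(scalar_linearE ll).
Qed.

Lemma polyfun1_cst (c : R) : polyfun 1 (fun _ : E => c).
Proof.
exists c, (fun _ _ => 0); split=> [i|x]; first by exists 0.
by rewrite big1 ?addr0// => i _; rewrite mulr0.
Qed.

Lemma spaceP1_const m c : altform fullv m c -> spaceP o T 1 m (fun=> c).
Proof.
move=> ac; split; first by move=> x _; exact: altform_restrict.
by move=> vs _; exists (fun=> c vs) => //; exact: polyfun1_cst.
Qed.

Lemma spaceP1_kappa_const m c : altform fullv (m + 1) c ->
  spaceP o T 1 m (kappa o T (fun=> c)).
Proof.
move=> ac; split; first by move=> x _; apply/altform_restrict/altform_cons.
move=> vs _; have lc := altform_cons_linear vs ac.
exists (fun x => - c (barycentre o T :: vs) + c (x :: vs)).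
  exact: (@polyfun1_affine (fun x => c (x :: vs))).
move=> x _; rewrite /kappa addrC -scaleN1r.
by have := lc (-1) (barycentre o T) x; rewrite mulN1r.
Qed.

Lemma spaceW_const m c : altform fullv m c -> (m = 0 -> c [::] = 0) ->
  spaceW o T m (fun=> c).
Proof.
move=> ac c0; split; first split.
- exact: spaceP1_const.
- by apply: spaceP1_kappa_const; rewrite subrK.
- by move=> /c0 c00; apply: integral_fun_eq0 => x _.
Qed.

(** Contracting twice with the same field gives zero by alternation, whence
    the condition on kappa in the definition of P_-. *)
Lemma spaceW_kappa_const m c : altform fullv (m + 1) c ->
    (m = 0 -> integral_fun o T (fun x => c [:: x - barycentre o T]) = 0) ->
  spaceW o T m (kappa o T (fun=> c)).
Proof.
move=> ac c0; split=> //; split; first exact: spaceP1_kappa_const.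
rewrite (_ : kappa o T (kappa o T _) = @zero_form R n); first exact: spaceP_zero.
apply/funext => x; apply/funext => vs.
exact: (altform_adjacent ac (x - barycentre o T) [::] vs).
Qed.

Lemma smooth_form_kappa_const m c : altform fullv (m + 1) c ->
  smooth_form m (kappa o T (fun=> c)).
Proof.
move=> ac; split=> [x|vs]; first exact: altform_cons.
have lc := altform_cons_linear vs ac.
have -> : (kappa o T (fun=> c))^~ vs =
    (fun x => 1 * c (x :: vs) + cst (- c (barycentre o T :: vs)) x).
  apply/funext => x; rewrite /kappa addrC -scaleN1r mul1r.
  by rewrite (lc (-1)) mulN1r addrC.
by apply: smooth_affine; [exact: smooth_scalar_linear|exact: smooth_cst].
Qed.

Lemma dsmooth_kappa_const m c : altform fullv m c ->
  dsmooth (kappa o T (fun=> c)) = fun _ vs => (size vs)%:R * c vs.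
Proof.
move=> ac; apply/funext => x; apply/funext => vs; apply: dsmooth_koszul.
  exact: altform_multilinear ac.
exact: altform_adjacent ac.
Qed.

(** A constant form on T only knows tangent vectors; precomposing it with a
    projection onto the tangent space yields a form on the ambient space, as
    smooth test forms must be. *)
Lemma spaceP0_extend m (a : dform) : T !=set0 -> spaceP o T 0 m a ->
  exists2 c, altform fullv m c & forall x vs, T x -> {subset vs <= tangent o T} ->
    a x vs = c vs.
Proof.
move=> [x0 Tx0] [forma pa]; pose p (v : E) := projv (tangent o T) v.
have pT vs : {subset map p vs <= tangent o T}.
  by move=> _ /mapP[v _ ->]; exact: memv_proj.
exists (fun vs => a x0 (map p vs)) => [|x vs Tx vsT].
  have [H1 H2 H3] := forma x0 Tx0; apply/altformP; split.
  - by move=> vs /(H1 _ (pT vs)); rewrite size_map.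
  - move=> b v v' vs1 vs2; rewrite !map_cat /= /p linearP H2//.
    have := pT (v :: v' :: vs1 ++ vs2); rewrite /= map_cat; exact.
  - by move=> vs nu; apply: H3 => //; apply: contra nu; exact: map_uniq.
have -> : map p vs = vs.
  rewrite -[RHS]map_id; apply/eq_in_map => v /vsT vT; exact: projv_id.
by have [q [c0 qc] aq] := pa vs vsT; rewrite !aq// !qc.
Qed.

End constant_forms.

(** * The exterior derivative on B *)

Section spaceB.
Context {R : realType} {n : nat} (o : set 'rV[R]_n -> seq 'rV[R]_n) (T : set 'rV[R]_n).
Notation E := 'rV[R]_n.
Notation dform := (@dform R n).
Hypothesis fT : orthonormal_frame T (o T).
Hypothesis bT : forall w : E, exists M : R, forall x, T x -> `|dotv x w| <= M.
Hypothesis T0 : T !=set0.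

Lemma integral_form_eq (u v : dform) :
    (forall x, T x -> u x (o T) = v x (o T)) ->
  integral_form o T u = integral_form o T v.
Proof. exact: integral_fun_eq. Qed.

Lemma integral_wedge_kappa (u a : dform) c : volume o T != 0 ->
    (forall x vs, T x -> {subset vs <= tangent o T} -> a x vs = c vs) ->
  integral_form o T (wedge u (kappa o T a)) =
  integral_form o T (wedge u (kappa o T (fun=> c))).
Proof.
move=> V0 ac; apply: integral_form_eq => x Tx; apply: eq_bigr => s _.
congr (_ * _); rewrite /kappa; apply: ac => // v; rewrite inE => /orP[/eqP->|].
  exact: sub_barycentre_tangent.
exact: mask_tangent.
Qed.

(** The contraction of a constant form belongs to W; in degree 0 this uses
    that the field x - b_T is centred. *)
Lemma spaceZ0_kappa k (u b : dform) : spaceZ0 o T k u ->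
    spaceP o T 0 ((dim o T)%:Z - k + 1) b ->
  integral_form o T (wedge u (kappa o T b)) = 0.
Proof.
move=> [_ Zu] Pb; have [V0|V0] := eqVneq (volume o T) 0.
  exact: volume0_integral.
have [c ac bc] := spaceP0_extend T0 Pb.
rewrite (integral_wedge_kappa _ V0 bc); apply: Zu.
apply: spaceW_kappa_const => // l0.
exact: (integral_centred fT bT V0 (altform_cons_linear [::] ac)).
Qed.

(** By the Stokes formula, without boundary term in X_0, d moves from u to the
    contraction of a, where it gives a constant multiple of a; constant forms
    of positive degree belong to W, and in degree 0 the contraction vanishes. *)
Lemma spaceZ0_ext_d_kappa k (u a : dform) : spaceZ0 o T k u ->
    spaceP o T 0 ((dim o T)%:Z - k) a ->
  integral_form o T (wedge (ext_d o T k u) (kappa o T a)) = 0.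
Proof.
move=> [[_ X0u] Zu] Pa; have [V0|V0] := eqVneq (volume o T) 0.
  exact: volume0_integral.
have [c ac aE] := spaceP0_extend T0 Pa.
rewrite (integral_wedge_kappa _ V0 aE).
have := X0u (kappa o T (fun=> c)); rewrite /stokes.
rewrite (dsmooth_kappa_const _ _ ac) Zu ?mulr0 ?addr0.
  by apply; apply: smooth_form_kappa_const; rewrite subrK.
apply: spaceW_const; first exact: altform_size_scale.
by rewrite mul0r.
Qed.

(** The derivative U of u is closed, so that zero multipliers solve the first
    equation for U and the second one is void. The third equation for U is the
    second one for u. The fourth one, orthogonality of U to the derivatives of
    Y^k, is the first equation for u tested with v' in Y^k: its three other
    terms vanish because Y^k is contained in Z_0^k and orthogonal to the
    derivatives of Z_0^(k-1). *)
Theorem spaceB_ext_d k (u : dform) :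
  spaceB o T k u -> spaceB o T (k + 1) (ext_d o T k u).
Proof.
move=> [Xu Bu]; split; first exact: spaceX_ext_d.
move=> dT; have [a [b [v [Pa Pb [Zv _] [eq1 eq2 _ _]]]]] := Bu dT.
have dd0 := ext_d_ext_d_ae_zero fT Xu.
have l1 : (dim o T)%:Z - (k + 1) + 1 = (dim o T)%:Z - k by rewrite opprD addrA subrK.
exists (@zero_form R n), (@zero_form R n), (@zero_form R n); split.
- exact: spaceP_zero.
- exact: spaceP_zero.
- exact: spaceY_zero.
split.
- move=> u' _ du'; rewrite (ae_zero_dot _ dd0) kappa_zero !wedge_zero_r.
  rewrite dot_formC (ae_zero_dot _ (ext_d_zero_form fT _)).
  by rewrite !addr0.
- by move=> a' _; exact: ae_zero_wedge.
- by rewrite l1; exact: eq2.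
- rewrite addrK => v' [Zv' v'd].
  have /= := eq1 v' Zv'.1.
  by rewrite (spaceZ0_ext_d_kappa Zv' Pa) (spaceZ0_kappa Zv' Pb) (v'd _ Zv) !addr0.
Qed.

End spaceB.

(** * Faces and traces *)

Section faces.
Context {R : realType} {n : nat}.
Notation E := 'rV[R]_n.
Implicit Types (T F G : set E).

(** A linear functional is bounded on a convex hull by the sum of its absolute
    values at the generators. *)
Lemma polytope_bounded T : polytope T ->
  forall w, exists M : R, forall x, T x -> `|dotv x w| <= M.
Proof.
move=> [s _ ->] w; exists (\sum_(i < size s) `|dotv s`_i w|) => x [c [c0 c1 ->]].
rewrite (scalar_linear_sum (dotv_linear w)); apply: (le_trans (ler_norm_sum _ _ _)).
apply: ler_sum => i _; rewrite (scalar_linearZ (dotv_linear w)) normrM.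
rewrite ger0_norm// ler_piMl// -c1 (bigD1 i)//= lerDl.
by apply: sumr_ge0.
Qed.

Lemma face_trans G F T : face G F -> face F T -> face G T.
Proof.
move=> [GF G0 cG Gext] [FT _ _ Fext]; split => //; first exact: subset_trans FT.
move=> x y t Tx Ty t01 Gxy; have [Fx Fy] := Fext x y t Tx Ty t01 (GF _ Gxy).
exact: Gext Gxy.
Qed.

Variable o : set E -> seq E.

(** If x in G were relatively interior to F, every y in F could be prolonged
    beyond x to a point of F, and the open segment would meet G at x; then y
    would belong to G, and G would be all of F. *)
Lemma facet_disjoint_relint G F : orthonormal_frame F (o F) ->
  facet o G F -> G `<=` F `\` relint o F.
Proof.
move=> [_ sF _] [[GF _ _ Gext] dimFG] x Gx; split; first exact: GF.
move=> [Fx [e e0 He]].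
suff FG : F `<=` G.
  have FeqG : F = G by apply/seteqP.
  by move: dimFG; rewrite FeqG => /eqP; rewrite -{1}(add0n (dim o G)) -addn1 addnC eqn_add2l.
move=> y Fy; have [v yE vF] : exists2 v, y = x + v & v \in tangent o F.
  by exists (y - x); [rewrite addrC subrK|exact: sF].
(* The point x - t v is within e of x, and x is the point of parameter t / (1
   + t) on the segment from x - t v to y = x + v. *)
pose t := e / 2 / (1 + `|v|).
have v1 : 0 < 1 + `|v| by rewrite ltr_pwDl.
have t0 : 0 < t by rewrite !divr_gt0.
have Fz : F (x + - t *: v).
  apply: He; first exact: memvZ.
  rewrite normrZ normrN gtr0_norm//.
  apply: (@le_lt_trans _ _ (t * (1 + `|v|))).
    by rewrite ler_pM2l// lerDr.
  by rewrite divfK ?gt_eqF// ltr_pdivrMr// ltr_pMr// ltr1n.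
pose r := t / (1 + t).
have t1 : 1 + t != 0 by rewrite gt_eqF// addr_gt0.
have r01 : 0 < r < 1.
  by rewrite divr_gt0 ?addr_gt0//= ltr_pdivrMr ?addr_gt0// mul1r ltrDr.
have xE : (1 - r) *: (x + - t *: v) + r *: y = x.
  rewrite yE !scalerDr addrACA -scalerDl subrK scale1r scalerA -scalerDl.
  rewrite (_ : (1 - r) * - t + r = 0) ?scale0r ?addr0//.
  by rewrite /r; field.
by have := Gext _ _ _ Fz Fy r01; rewrite xE => /(_ Gx)[].
Qed.

(** So test forms for the trace on G, which may live near G only, restrict to
    test forms for the weak derivative on G. *)
Lemma facet_relbd G F : orthonormal_frame F (o F) -> facet o G F ->
  relbd o G `<=` relbd o F `\` relint o G.
Proof. by move=> fF GF x [Gx nGx]; split => //; exact: (facet_disjoint_relint fF GF). Qed.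

Lemma vanishes_nearS (S S' : set E) (phi : dform) :
  S `<=` S' -> vanishes_near S' phi -> vanishes_near S phi.
Proof. by move=> SS' [U [oU S'U U0]]; exists U; split => //; exact: subset_trans S'U. Qed.

(** Both sides come from the Stokes pairing with d phi: on F, where du is
    closed and d d phi = 0, it gives the pairing of du with phi; on G,
    integration by parts without boundary term turns the pairing of g with d
    phi into that of dg with phi. The sign that goes with the degree k + 1 on
    F matches the one of the integration by parts on G. *)
Lemma facet_trace_ext_d F G k (u g : dform) :
    orthonormal_frame F (o F) -> orthonormal_frame G (o G) -> facet o G F ->
    spaceX o F k u -> spaceX o G k g ->
  facet_trace o F G k u g ->
  facet_trace o F G (k + 1) (ext_d o F k u) (ext_d o G k g).
Proof.
move=> fF fG FG Xu Xg [nu nuP tr]; exists nu => // phi.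
rewrite opprD addrA => sphi vphi.
have ddphi : dsmooth (dsmooth phi) = @zero_form R n.
  apply/funext => x; apply/funext => vs; apply: dsmooth_dsmooth; exact: sphi.2.
have sdphi : smooth_form ((dim o F)%:Z - k - 1) (dsmooth phi).
  by rewrite -[X in smooth_form X _](subrK 1 _); exact: smooth_form_dsmooth.
have vphiG : vanishes_near (relbd o G) phi.
  exact: vanishes_nearS (facet_relbd fF FG) vphi.
have sphiG : smooth_form ((dim o G)%:Z - k - 1) phi.
  rewrite (_ : _ - 1 = (dim o F)%:Z - k - 1 - 1)//.
  by rewrite FG.2 -addn1 PoszD; ring.
have := tr _ sdphi (vanishes_near_dsmooth vphi).
have [_ /(_ _ sphiG vphiG)] := ext_dP Xg.
rewrite /stokes ddphi !wedge_zero_r mulr0 addr0 => sG trF.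
rewrite (ae_zero_wedge _ (ext_d_ext_d_ae_zero fF Xu)) add0r trF.
rewrite exprzDr ?unitrN1// expr1z.
move: sG => /eqP; rewrite addr_eq0 => /eqP ->.
by ring.
Qed.

Lemma traces_face T F k w : face F T -> traces o T k w -> traces o F k w.
Proof.
move=> FT [Xw trw]; split=> [G GF|G H GF HG]; first exact/Xw/(face_trans GF).
by apply: trw => //; exact: face_trans FT.
Qed.

Lemma traces_ext_d T k w : (forall F, face F T -> orthonormal_frame F (o F)) ->
  traces o T k w -> traces o T (k + 1) (fun F => ext_d o F k (w F)).
Proof.
move=> ho [Xw trw]; split=> [F FT|F G FT GF].
  exact/spaceX_ext_d/Xw.
have GT : face G T := face_trans GF.1 FT.
by apply: facet_trace_ext_d => //; [exact: ho|exact: ho|exact: Xw|exact: Xw|exact: trw].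
Qed.

End faces.

Theorem proposition2p6 (R : realType) (n : nat) (T : set 'rV[R]_n)
    (o : set 'rV[R]_n -> seq 'rV[R]_n)
    (hT : polytope T)
    (ho : forall F, face F T -> orthonormal_frame F (o F))
    (k : int) (u : dform) (hu : spaceA o T k u) :
  (forall F, face F T -> exists2 g, is_trace o T F k u g & spaceA o F k g)
  /\ spaceA o T (k + 1) (ext_d o T k u).
Proof.
have [Xu [w [trw wT Bw]]] := hu; split.
  move=> F FT; exists (w F); first by exists w.
  split; first exact: trw.1.
  exists w; split => //; first exact: traces_face trw.
  by move=> G GF; apply: Bw; exact: face_trans FT.
split; first exact: spaceX_ext_d.
exists (fun F => ext_d o F k (w F)); split=> [||F FT].
- exact: traces_ext_d.
- by rewrite wT.
- have [FsubT F0 _ _] := FT.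
  apply: spaceB_ext_d (Bw F FT) => //; first exact: ho.
  move=> v; have [M HM] := polytope_bounded hT v.
  by exists M => x /FsubT; exact: HM.
Qed.
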